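(* Let $\nu\ge 0$, $\kappa\ge 0$, $0<\alpha\le 1$, $0<\beta\le 1$ be real parameters and let $P(\Lambda)$ be a Fourier multiplier operator on $\mathbb{R}^2$, $\widehat{P(\Lambda)f}(\xi)=P(|\xi|)\widehat f(\xi)$. For classical solutions that decay sufficiently fast as $|x|\to\infty$, the system $$ \left\{ \begin{array}{l} \partial_t \omega + u\cdot\nabla\omega + \nu \Lambda^\alpha \omega = \partial_{x_1}\theta,\\ u =\nabla^\perp \psi, \quad \Delta \psi = P(\Lambda)\omega,\\ \partial_t \theta + u\cdot \nabla \theta + \kappa \Lambda^\beta \theta =0 \end{array} \right. $$ is equivalent to the system $$ \left\{ \begin{array}{l} \partial_t v + u^\perp (\nabla^\perp \cdot v) + \nu \Lambda^\alpha v=-\nabla p + \theta \mathbf{e}_2,\\ \nabla \cdot v=0,\quad u = P(\Lambda) v,\\ \partial_t \theta + u\cdot \nabla \theta + \kappa \Lambda^\beta \theta =0. \end{array} \right. $$ In addition, the equation for $v$ can be written in the form $$ \partial_t v + u\cdot\nabla v -\sum_{j=1}^2 u_j \nabla v_j + \nu \Lambda^\alpha v=-\nabla p + \theta \mathbf{e}_2. $$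
   Context: Here $\omega,\psi,\theta,p$ are scalar functions and $u=(u_1,u_2)$, $v=(v_1,v_2)$ are vector fields of $x\in\mathbb{R}^2$, $t\ge0$. $\Lambda^\alpha$ is the Fourier multiplier with symbol $|\xi|^\alpha$. $\nabla^\perp=(-\partial_{x_2},\partial_{x_1})$, $u^\perp=(-u_2,u_1)$, $\mathbf{e}_2=(0,1)$, $\nabla\times v=\nabla^\perp\cdot v=\partial_{x_1}v_2-\partial_{x_2}v_1$. The unknowns of the two systems are related by $\omega=\nabla\times v$ (with $\nabla\cdot v=0$), i.e. $v=\nabla^\perp\Delta^{-1}\omega$, equivalently $v=P(\Lambda)^{-1}u$. *)

(* Defs.v *)
From mathcomp Require Import all_boot all_order all_algebra.
From mathcomp Require Import all_classical all_reals all_analysis.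
From mathcomp Require Import complex.
Set Implicit Arguments.
Unset Strict Implicit.
Unset Printing Implicit Defensive.
Import Order.TTheory GRing.Theory Num.Theory.
Import numFieldNormedType.Exports.
Local Open Scope classical_set_scope.
Local Open Scope ring_scope.
Local Open Scope complex_scope.

(* A point or vector of the plane is a pair.  A scalar field depending on time
   is a function f : R -> R * R -> R, with f t x meaningful for 0 <= t only. *)

Section Plane.
Variable R : realType.
Implicit Types (x y xi : R * R) (g h phi psi : R * R -> R).
Implicit Types (V : R * R -> R * R) (F G m : R * R -> R[i]).

Definition dot x y : R := x.1 * y.1 + x.2 * y.2.
Definition enorm x : R := Num.sqrt (dot x x).
Definition perp x : R * R := (- x.2, x.1).
Definition smul (a : R) x : R * R := (a * x.1, a * x.2).
Definition e2 : R * R := (0, 1).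

Definition fst_comp V : R * R -> R := fun x => (V x).1.
Definition snd_comp V : R * R -> R := fun x => (V x).2.

Definition dx1 g : R * R -> R := fun x => derive1 (fun s : R => g (s, x.2)) x.1.
Definition dx2 g : R * R -> R := fun x => derive1 (fun s : R => g (x.1, s)) x.2.

Definition has_partials g : Prop := forall x,
  derivable (fun s : R => g (s, x.2)) x.1 1 /\
  derivable (fun s : R => g (x.1, s)) x.2 1.

Definition C1_space g : Prop :=
  [/\ has_partials g, continuous g, continuous (dx1 g) & continuous (dx2 g)].

Definition C2_space g : Prop :=
  [/\ C1_space g, C1_space (dx1 g) & C1_space (dx2 g)].

Definition grad g x : R * R := (dx1 g x, dx2 g x).
Definition grad_perp g x : R * R := (- dx2 g x, dx1 g x).
Definition laplacian g x : R := dx1 (dx1 g) x + dx2 (dx2 g) x.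
Definition div V x : R := dx1 (fst_comp V) x + dx2 (snd_comp V) x.
Definition curl V x : R := dx1 (snd_comp V) x - dx2 (fst_comp V) x.
Definition advect V g x : R := dot (V x) (grad g x).

Definition plane_measure :=
  (@lebesgue_measure R \x @lebesgue_measure R)%E.

Definition cintegral F : R[i] :=
  (\int[plane_measure]_x complex.Re (F x)) +i*
  (\int[plane_measure]_x complex.Im (F x)).

(* Iterated partial derivative along a word: true stands for x_1. *)
Definition partials (w : seq bool) phi : R * R -> R :=
  foldr (fun b g => if b then dx1 g else dx2 g) phi w.

Definition schwartz phi : Prop := forall w : seq bool,
  has_partials (partials w phi) /\
  forall N : nat, exists C : R, forall x,
    (1 + enorm x) ^+ N * `|partials w phi x| <= C.

Definition fourier_integral phi xi : R[i] :=
  cintegral (fun x =>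
    (phi x)%:C * (cos (dot x xi) +i* (- sin (dot x xi)))).

Definition tempered g : Prop := exists N : nat,
  plane_measure.-integrable setT
    (fun x => (g x / (1 + enorm x) ^+ N)%:E).

(* The Fourier transform of the tempered distribution g is the function F:
   <g^, phi> = <g, phi^> for every test function phi.  By linearity in phi,
   real-valued test functions suffice. *)
Definition is_fourier g F : Prop :=
  [/\ tempered g,
      tempered (fun xi => complex.Re (F xi)),
      tempered (fun xi => complex.Im (F xi)) &
      forall phi, schwartz phi ->
        cintegral (fun x => (g x)%:C * fourier_integral phi x) =
        cintegral (fun xi => F xi * (phi xi)%:C)].

(* h is the image of g under the Fourier multiplier operator of symbol m. *)
Definition fourier_multiplier m g h : Prop := exists F G,
  [/\ is_fourier g F, is_fourier h G &
      {ae plane_measure, forall xi, G xi = m xi * F xi}].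

(* The symbol of P(Lambda). *)
Definition radial (P : R -> R[i]) : R * R -> R[i] := fun xi => P (enorm xi).

(* The symbol of c Lambda^a.  The coefficient is kept inside the symbol so
   that for c = 0 the operator is 0, with no condition that Lambda^a g be a
   function. *)
Definition dissipation (c a : R) : R * R -> R[i] :=
  radial (fun r => (c * r `^ a)%:C).

Definition vanishes_at_infinity g : Prop := forall e : R, 0 < e ->
  exists M : R, forall x, M < enorm x -> `|g x| < e.

(* Decay at infinity includes that the Fourier transform is a function, so that
   Fourier multipliers act by pointwise multiplication of it.  This holds for
   instance for g in L^p with 1 <= p <= 2, but also for velocities of size
   1 / |x| generated by a vorticity of nonzero mean. *)
Definition decaying g : Prop :=
  [/\ C1_space g, vanishes_at_infinity g,
      vanishes_at_infinity (dx1 g), vanishes_at_infinity (dx2 g) &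
      exists F, is_fourier g F].

End Plane.

Section SpaceTime.
Variable R : realType.
Implicit Types (f omega psi theta p : R -> R * R -> R).
Implicit Types (u v : R -> R * R -> R * R).

Definition time_quotient f (t : R) (x : R * R) : R -> R :=
  fun h => h^-1 * (f (t + h) x - f t x).

(* Increments h staying in t + h >= 0: the derivative is one-sided at t = 0. *)
Definition time_increments (t : R) : set_system R :=
  within [set h : R | 0 <= t + h] (0 : R)^'.

Definition has_dt f : Prop := forall t x, 0 <= t ->
  cvg (time_quotient f t x @ time_increments t).

Definition dt f (t : R) (x : R * R) : R :=
  lim (time_quotient f t x @ time_increments t).

Definition continuous_spacetime f : Prop :=
  {within [set z : R * (R * R) | 0 <= z.1], continuous (fun z => f z.1 z.2)}.

Definition C1_spacetime f : Prop :=
  [/\ has_dt f, (forall t, 0 <= t -> has_partials (f t)),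
      continuous_spacetime f, continuous_spacetime (dt f) &
      continuous_spacetime (fun t => dx1 (f t)) /\
      continuous_spacetime (fun t => dx2 (f t))].

Definition dt_vec v (t : R) (x : R * R) : R * R :=
  (dt (fun s => fst_comp (v s)) t x, dt (fun s => snd_comp (v s)) t x).

Definition vector_multiplier (m : R * R -> R[i]) (V W : R * R -> R * R) :=
  fourier_multiplier m (fst_comp V) (fst_comp W) /\
  fourier_multiplier m (snd_comp V) (snd_comp W).

Definition decaying_vector (V : R * R -> R * R) : Prop :=
  decaying (fst_comp V) /\ decaying (snd_comp V).

(* The last field says that the term nu Lambda^alpha v of the velocity
   equation is itself a classical decaying field. *)
Record classical_decaying (nu alpha : R) u v theta : Prop := {
  cd_v1 : C1_spacetime (fun t => fst_comp (v t));
  cd_v2 : C1_spacetime (fun t => snd_comp (v t));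
  cd_dx1_v1 : C1_spacetime (fun t => dx1 (fst_comp (v t)));
  cd_dx2_v1 : C1_spacetime (fun t => dx2 (fst_comp (v t)));
  cd_dx1_v2 : C1_spacetime (fun t => dx1 (snd_comp (v t)));
  cd_dx2_v2 : C1_spacetime (fun t => dx2 (snd_comp (v t)));
  cd_theta : C1_spacetime theta;
  cd_decay_v : forall t, 0 <= t -> decaying_vector (v t);
  cd_decay_u : forall t, 0 <= t -> decaying_vector (u t);
  cd_decay_theta : forall t, 0 <= t -> decaying (theta t);
  cd_dissipation : forall t, 0 <= t -> exists D : R * R -> R * R,
    vector_multiplier (dissipation nu alpha) (v t) D /\ decaying_vector D }.

Definition temperature_equation (kappa beta : R) u theta : Prop :=
  forall t, 0 <= t -> exists D : R * R -> R,
    fourier_multiplier (dissipation kappa beta) (theta t) D /\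
    forall x, dt theta t x + advect (u t) (theta t) x + D x = 0.

Definition vorticity_equation (nu alpha : R) omega u theta : Prop :=
  forall t, 0 <= t -> exists D : R * R -> R,
    fourier_multiplier (dissipation nu alpha) (omega t) D /\
    forall x,
      dt omega t x + advect (u t) (omega t) x + D x = dx1 (theta t) x.

Definition vorticity_system (nu kappa alpha beta : R) (P : R -> R[i])
    omega u psi theta : Prop :=
  [/\ vorticity_equation nu alpha omega u theta,
      forall t, 0 <= t ->
        [/\ C2_space (psi t), u t =1 grad_perp (psi t) &
            fourier_multiplier (radial P) (omega t) (laplacian (psi t))] &
      temperature_equation kappa beta u theta].

(* u^perp (nabla^perp . v) *)
Definition curl_nonlinearity (U V : R * R -> R * R) (x : R * R) : R * R :=
  smul (curl V x) (perp (U x)).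

(* u . nabla v - sum_j u_j nabla v_j *)
Definition advective_nonlinearity (U V : R * R -> R * R) (x : R * R) : R * R :=
  (advect U (fst_comp V) x, advect U (snd_comp V) x)
  - (smul (U x).1 (grad (fst_comp V) x) + smul (U x).2 (grad (snd_comp V) x)).

Definition velocity_equation
    (nonlinearity : (R * R -> R * R) -> (R * R -> R * R) -> R * R -> R * R)
    (nu alpha : R) v u p theta : Prop :=
  forall t, 0 <= t -> exists D : R * R -> R * R,
    vector_multiplier (dissipation nu alpha) (v t) D /\
    forall x,
      dt_vec v t x + nonlinearity (u t) (v t) x + D x =
      - grad (p t) x + smul (theta t x) (e2 R).

Definition velocity_system (nu kappa alpha beta : R) (P : R -> R[i])
    v u p theta : Prop :=
  [/\ (forall t, 0 <= t -> C1_space (p t)),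
      velocity_equation curl_nonlinearity nu alpha v u p theta,
      forall t, 0 <= t -> forall x, div (v t) x = 0,
      forall t, 0 <= t -> vector_multiplier (radial P) (v t) (u t) &
      temperature_equation kappa beta u theta].

End SpaceTime.

(* Main.v *)
Require Import Defs.
From mathcomp Require Import all_boot all_order all_algebra.
From mathcomp Require Import all_classical all_reals all_analysis.
From mathcomp Require Import measurable_realfun complex.
From mathcomp Require Import ring lra.
Set Implicit Arguments.
Unset Strict Implicit.
Unset Printing Implicit Defensive.
Import Order.TTheory GRing.Theory Num.Theory.
Import numFieldNormedType.Exports.
Local Open Scope classical_set_scope.
Local Open Scope ring_scope.

(** Taking the curl of the velocity equation removes the pressure and turns
    u^perp (curl v) into div (omega u), which is u . grad omega because u is
    solenoidal; the dissipation and P(Lambda) commute with derivatives.  This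
    gives the vorticity equation.  Conversely, given the vorticity equation,
    everything in the velocity equation except the pressure gradient is a
    curl-free C^1 field on the whole plane, hence minus the gradient of some p
    by the Poincare lemma ([poincare], [curl_residual]).  Likewise u is solenoidal
    exactly when it has a stream function, whose Laplacian is then curl u
    ([stream_function], [stream_function_solenoidal]).  The advective form of
    the nonlinearity is a pointwise identity.

    Two points need more than vector calculus.  First, curl must be applied to
    dt v, whereas what is given is that v and its first space derivatives are
    differentiable in time, one-sidedly at the initial time; [mixed_derivative]
    exchanges the two derivatives.  Second, Lambda^alpha and P(Lambda) are known only
    through the relation between a tempered function and its Fourier transform,
    so one has to know that
    - differentiation multiplies the transform by i xi_b ([is_fourier_pd]);
    - a tempered function is determined by its transform, and conversely
      ([fourier_injective], [fourier_unique]).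
    The first gives the relation between curl v and curl u, or between curl v
    and the curl of the dissipation, from the one between v and u, and also the
    reverse implication for solenoidal fields, since a planar vector is
    determined by its components along and across a nonzero frequency
    ([vector_multiplier_of_curl]).  The second makes the dissipative terms of
    the two equations comparable: both are continuous, hence equal everywhere
    ([fourier_multiplier_unique]).

    Both uniqueness statements reduce to one: a tempered function whose
    integrals against all Gaussians vanish is zero almost everywhere
    ([gaussian_separation]).  For the transform this is testing with Gaussians;
    for the function it is testing with modulated Gaussians, whose transforms
    are translated Gaussians ([wave_gaussian]).  The separation statement holds
    because a suitable polynomial in a Gaussian of one variable approximates
    the indicator of an interval, so that the integrals over all rectangles
    vanish. *)

(** * Real calculus *)

Section RealLine.
Variable R : realType.
Implicit Types (f df : R -> R) (a b l : R).

Lemma is_derive_epsP f a l :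
  is_derive a 1 f l <->
  (forall e : R, 0 < e -> exists2 d : R, 0 < d &
     forall k, k != 0 -> `|k| < d -> `|k^-1 * (f (a + k) - f a) - l| <= e).
Proof.
have eqq : (fun h : R => h^-1 *: ((f \o shift a) (h *: (1 : R)) - f a)) =
           (fun k => k^-1 * (f (a + k) - f a)).
  by apply/funext => k; rewrite /= /GRing.scale /= mulr1 [a + k]addrC.
split.
- move=> [df ld] e e0.
  have /cvgrPdist_le : (fun k => k^-1 * (f (a + k) - f a)) @ 0^' --> l.
    by rewrite -eqq -ld; exact: df.
  move=> /(_ _ e0) [d /= d0 dP]; exists d => // k k0 kd.
  by rewrite distrC; apply: dP; rewrite //= sub0r normrN.
- move=> h.
  have cv : (fun k => k^-1 * (f (a + k) - f a)) @ 0^' --> l.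
    apply/cvgrPdist_le => e e0; have [d d0 dP] := h e e0.
    exists d => //= k /=; rewrite sub0r normrN => kd k0.
    by rewrite distrC dP.
  rewrite -eqq in cv.
  by apply: DeriveDef; [apply/cvg_ex; exists l|exact/cvg_lim].
Qed.

Lemma is_derive_right f a l : is_derive a 1 f l ->
  h^-1 * (f (a + h) - f a) @[h --> 0^'+] --> l.
Proof.
move=> /is_derive_epsP fl; apply/cvgrPdist_le => e e0.
have [d d0 dP] := fl e e0; exists d => //= h /=; rewrite sub0r normrN => hd h0.
by rewrite distrC dP // gt_eqF.
Qed.

(** The endpoints come in either order, so c is located by its distance to a. *)
Lemma mean_value f df a b :
  (forall c, `|c - a| <= `|b - a| -> is_derive c 1 f (df c)) ->
  exists2 c, `|c - a| <= `|b - a| & f b - f a = df c * (b - a).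
Proof.
move=> h.
have dc c : `|c - a| <= `|b - a| -> {for c, continuous f}.
  by move=> /h [fc _]; exact/differentiable_continuous/derivable1_diffP.
have [ab|ba] := leP a b.
- have [||c] := @MVT_segment R f df a b ab.
  + by move=> x /[!in_itv]/= /andP[? ?]; apply: h; rewrite !ger0_norm; lra.
  + apply: continuous_in_subspaceT => x /[!inE]/= /[!in_itv]/= /andP[? ?].
    by apply: dc; rewrite !ger0_norm; lra.
  by rewrite in_itv/= => /andP[? ?]; exists c => //; rewrite !ger0_norm; lra.
- have [||c] := @MVT_segment R f df b a (ltW ba).
  + by move=> x /[!in_itv]/= /andP[? ?]; apply: h; rewrite !ler0_norm; lra.
  + apply: continuous_in_subspaceT => x /[!inE]/= /[!in_itv]/= /andP[? ?].
    by apply: dc; rewrite !ler0_norm; lra.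
  rewrite in_itv/= => /andP[? ?] e; exists c; first by rewrite !ler0_norm; lra.
  lra.
Qed.

(** Exchange of two derivatives when the variable t is confined to one side
    of t0.  The increment in s of the difference quotient in t is, by two mean
    values, the mixed derivative Fst at a point near (t0, s0); let first the
    step in t and then the step in s tend to 0.  With t the time this moves dt
    across a space derivative; with t a coordinate it is the symmetry of
    second derivatives. *)
Lemma mixed_derivative (F Fs Fst : R -> R -> R) (A : R -> R) (t0 s0 L : R) :
  (forall t s : R, t0 <= t -> is_derive s 1 (F t) (Fs t s)) ->
  (forall t s : R, t0 < t -> is_derive t 1 (Fs^~ s) (Fst t s)) ->
  (forall t s : R, {within `[t0, t], continuous (Fs^~ s)}) ->
  (forall s, h^-1 * (F (t0 + h) s - F t0 s) @[h --> 0^'+] --> A s) ->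
  (forall e : R, 0 < e -> exists2 r : R, 0 < r &
     forall t s, t0 < t -> t < t0 + r -> `|s - s0| < r -> `|Fst t s - L| <= e) ->
  is_derive s0 1 A L.
Proof.
move=> Fd Fsd Fsc FA FstL; apply/is_derive_epsP => e e0.
have [r r0 rP] := FstL _ e0; exists r => // k k0 kr.
pose q h := k^-1 * (h^-1 * (F (t0 + h) (s0 + k) - F t0 (s0 + k))
                    - h^-1 * (F (t0 + h) s0 - F t0 s0)).
have qA : q h @[h --> 0^'+] --> k^-1 * (A (s0 + k) - A s0).
  by apply: cvgMr; apply: cvgB; exact: FA.
have qAL : `|q h - L| @[h --> 0^'+] --> `|k^-1 * (A (s0 + k) - A s0) - L|.
  by apply: cvg_norm; apply: cvgB => //; exact: cvg_cst.
apply: (cvgr_to_le qAL).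
near=> h.
have h0 : 0 < h by near: h; exact: nbhs_right_gt.
have hr : h < r by near: h; exact: nbhs_right_lt.
have dF (c : R) : is_derive c 1 (fun s => F (t0 + h) s - F t0 s)
                          (Fs (t0 + h) c - Fs t0 c).
  by apply: is_deriveB; apply: Fd; lra.
have [c cs E1] := @mean_value _ _ s0 (s0 + k) (fun c : R => fun=> dF c).
have [|||c' c'P E2] := @MVT R (Fs^~ c) (Fst^~ c) t0 (t0 + h).
- lra.
- by move=> t /[!in_itv]/= /andP[? ?]; apply: Fsd.
- exact: Fsc.
suff -> : q h = Fst c' c.
  move: c'P; rewrite in_itv/= => /andP[? ?]; apply: rP => //; first lra.
  by apply: le_lt_trans kr; rewrite (_ : k = s0 + k - s0)//; lra.
rewrite /q -mulrBr -[F (t0 + h) (s0 + k) - _ - _]/(_) E1 E2.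
by field; rewrite k0 gt_eqF.
Unshelve. all: by end_near. Qed.

End RealLine.

Section Primitive.
Variable R : realType.
Implicit Types (f : R -> R) (a x : R).

Let right_primitive f : continuous f -> exists Phi : R -> R,
  Phi 0 = 0 /\ forall x : R, - 1 < x -> is_derive x 1 Phi (f x).
Proof.
move=> cf; pose P x := \int[lebesgue_measure]_(t in `[-1, x]) f t.
exists (fun x => P x - P 0); split=> [|x x1]; first by rewrite subrr.
have [|||dP Px] := @continuous_FTC1_closed R f (-1) x (x + 1) _ _ x1.
- by rewrite ltrDl.
- by apply: continuous_compact_integrable;
    [exact: segment_compact|exact: continuous_subspaceT].
- exact: cf.
have dPx : is_derive x 1 P (f x) by apply: DeriveDef; rewrite -?derive1E.
by rewrite -[f x]subr0; apply: is_deriveB.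
Qed.

(** Integration from the base point -1 yields a primitive to the right of -1
    only.  The primitives obtained for f and for its mirror image agree on the
    overlap, where their difference has zero derivative, and are glued. *)
Lemma continuous_primitive f : continuous f -> exists Phi : R -> R,
  Phi 0 = 0 /\ forall x : R, is_derive x 1 Phi (f x).
Proof.
move=> cf; have [P [P0 dP]] := right_primitive cf.
have [|Q [Q0 dQ]] := @right_primitive (fun x => f (- x)).
  by move=> x; apply: continuous_comp; [exact: opp_continuous|exact: cf].
have dQN (x : R) : x < 1 -> is_derive x 1 (fun y => - Q (- y)) (f x).
  move=> x1; have -> : f x = - (f (- - x) * -1) by rewrite opprK; lra.
  by apply: is_deriveN; apply: (@is_derive1_comp _ Q -%R); apply: dQ; lra.
have PQ (x : R) : -1 < x -> x < 1 -> P x = - Q (- x).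
  move=> x1 x2.
  have [c|c] := @mean_value R (fun y => P y - - Q (- y)) (fun y => f y - f y) 0 x.
    rewrite !subr0 => cx; have : `|c| < 1 by rewrite (le_lt_trans cx)// ltr_norml x1.
    by move=> /ltr_normlP[? ?]; apply: is_deriveB; [apply: dP|apply: dQN]; lra.
  move=> _; rewrite subrr mul0r oppr0 P0 Q0; lra.
pose Phi x := if 0 <= x then P x else - Q (- x).
exists Phi; split=> [|x]; first by rewrite /Phi lexx.
have [x0|x0] := ltP (-1) x.
  apply: near_eq_is_derive (dP _ x0).
  near=> y; rewrite /Phi; case: leP => // y0.
  rewrite PQ //; last lra.
  by near: y; apply: lt_nbhsr; lra.
have xn1 : x < 1 by lra.
apply: near_eq_is_derive (dQN _ xn1).
near=> y; rewrite /Phi; case: leP => // y0.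
suff : y < 0 by lra.
by near: y; apply: lt_nbhsl; lra.
Unshelve. all: by end_near. Qed.

End Primitive.

(** * Partial derivatives in the plane *)

Section PlaneCalculus.
Variable R : realType.
Implicit Types (x y : R * R) (g h : R * R -> R) (b : bool).

Lemma nbhs_planeP x (P : set (R * R)) :
  nbhs x P <-> exists2 r : R, 0 < r &
    forall y, `|y.1 - x.1| < r -> `|y.2 - x.2| < r -> P y.
Proof.
split=> [/nbhs_ballP[r /= r0 rP]|[r r0 rP]].
- by exists r => // y y1 y2; apply: rP; split; rewrite /ball/= distrC.
- apply/nbhs_ballP; exists r => //= y [y1 y2]; apply: rP; rewrite distrC.
    exact: y1.
  exact: y2.
Qed.

Lemma continuous_planeP g x :
  {for x, continuous g} <-> (forall e : R, 0 < e -> exists2 r : R, 0 < r &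
    forall y, `|y.1 - x.1| < r -> `|y.2 - x.2| < r -> `|g y - g x| <= e).
Proof.
split=> [/cvgrPdist_le gx e e0|h].
- have /nbhs_planeP[r r0 rP] := gx e e0.
  by exists r => // y y1 y2; rewrite distrC; exact: rP.
- apply/cvgrPdist_le => e e0; apply/nbhs_planeP.
  by have [r r0 rP] := h e e0; exists r => // y y1 y2; rewrite distrC rP.
Qed.

(** A boolean names an axis, true being x_1 as in the words of [partials]; this
    lets one proof serve both coordinates. *)
Definition axis_point b x (s : R) : R * R := if b then (s, x.2) else (x.1, s).
Definition coord b x : R := if b then x.1 else x.2.
Definition pd b g : R * R -> R := if b then dx1 g else dx2 g.

(** The relational form carries existence and value together, so that the rules
    of calculus need no differentiability premises. *)
Definition is_pd b g x (l : R) : Prop :=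
  is_derive (coord b x) 1 (fun s => g (axis_point b x s)) l.

Lemma axis_point_coord b x : axis_point b x (coord b x) = x.
Proof. by case: b; case: x. Qed.

Lemma coord_axis_point b x s : coord b (axis_point b x s) = s.
Proof. by case: b. Qed.

Lemma axis_point_idem b x s t :
  axis_point b (axis_point b x s) t = axis_point b x t.
Proof. by case: b. Qed.

Lemma continuous_axis g b x : continuous g ->
  continuous (fun s => g (axis_point b x s)).
Proof.
move=> gc s; apply/cvgrPdist_le => e e0.
have /continuous_planeP/(_ e e0)[r r0 rP] := gc (axis_point b x s).
exists r => // s' /=; rewrite distrC => ss'; rewrite distrC.
by apply: rP; case: b => //=; rewrite subrr normr0.
Qed.

Lemma has_partialsP g b x : has_partials g -> is_pd b g x (pd b g x).
Proof.
move=> /(_ x)[g1 g2].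
by case: b; (apply: DeriveDef; last by rewrite -derive1E); [exact: g1|exact: g2].
Qed.

Lemma is_pd_val b g x l : is_pd b g x l -> pd b g x = l.
Proof.
by case: b => -[_ h]; rewrite /pd /dx1 /dx2 derive1E.
Qed.

Lemma partials_of g (d : bool -> R * R -> R) :
  (forall b x, is_pd b g x (d b x)) ->
  has_partials g /\ forall b, pd b g = d b.
Proof.
move=> gd; split=> [x|b]; last by apply/funext => x; exact/is_pd_val/gd.
by split; [have [] := gd true x|have [] := gd false x].
Qed.

Lemma is_pdD b g h x l m :
  is_pd b g x l -> is_pd b h x m -> is_pd b (fun y => g y + h y) x (l + m).
Proof. exact: is_deriveD. Qed.

Lemma is_pdN b g x l : is_pd b g x l -> is_pd b (fun y => - g y) x (- l).
Proof. exact: is_deriveN. Qed.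

Lemma is_pdB b g h x l m :
  is_pd b g x l -> is_pd b h x m -> is_pd b (fun y => g y - h y) x (l - m).
Proof. exact: is_deriveB. Qed.

Lemma is_pdM b g h x l m : is_pd b g x l -> is_pd b h x m ->
  is_pd b (fun y => g y * h y) x (l * h x + g x * m).
Proof.
move=> gl hm; have := is_deriveM gl hm; rewrite /is_pd.
by rewrite !axis_point_coord /GRing.scale /= addrC [h x * l]mulrC.
Qed.

Lemma is_pdZ b g x l (c : R) : is_pd b g x l -> is_pd b (fun y => c * g y) x (c * l).
Proof. exact: is_deriveZ. Qed.

Lemma is_pd_cst b x (c : R) : is_pd b (fun=> c) x 0.
Proof. exact: is_derive_cst. Qed.

Lemma is_pd_coord b b' x : is_pd b (coord b') x (b == b')%:R.
Proof.
by case: b b' => -[]; rewrite /is_pd /=; (exact: is_derive_id || exact: is_derive_cst).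
Qed.

Lemma is_pd_comp b g x l (f : R -> R) m :
  is_derive (g x) 1 f m -> is_pd b g x l ->
  is_pd b (fun y => f (g y)) x (m * l).
Proof.
move=> fm gl; apply: (@is_derive1_comp _ f (fun s => g (axis_point b x s))) gl.
by rewrite axis_point_coord.
Qed.

(** Move along one axis at a time: the mean value theorem bounds each increment
    by K times the displacement. *)
Lemma continuous_locally_bounded_partials g : has_partials g ->
  (forall x, exists (K r : R), 0 < r /\ forall b y,
     `|y.1 - x.1| < r -> `|y.2 - x.2| < r -> `|pd b g y| <= K) ->
  continuous g.
Proof.
move=> gp gK x; apply/continuous_planeP => e e0.
have [K [r [r0 rK]]] := gK x.
have K0 : 0 <= K.
  apply: le_trans (normr_ge0 (pd true g x)) _.
  by apply: rK; rewrite subrr normr0.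
exists (Num.min r (e / (2 * (K + 1)))).
  by rewrite lt_min r0 divr_gt0 // mulr_gt0 //; lra.
move=> y; rewrite !lt_min => /andP[y1r y1e] /andP[y2r y2e].
have [c cx Ec] := @mean_value R (fun s => g (s, y.2)) (fun s => pd true g (s, y.2))
  x.1 y.1 (fun c _ => has_partialsP true (c, y.2) gp).
have [d dx Ed] := @mean_value R (fun s => g (x.1, s)) (fun s => pd false g (x.1, s))
  x.2 y.2 (fun c _ => has_partialsP false (x.1, c) gp).
have -> : g y - g x = pd true g (c, y.2) * (y.1 - x.1)
                     + pd false g (x.1, d) * (y.2 - x.2).
  rewrite -Ec -Ed; case: (x) (y) => x1 x2 [y1 y2] /=; lra.
apply: le_trans (ler_normD _ _) _; rewrite !normrM.
have h1 : `|pd true g (c, y.2)| <= K by apply: rK => //=; exact: le_lt_trans y1r.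
have h2 : `|pd false g (x.1, d)| <= K.
  by apply: rK => /=; rewrite ?subrr ?normr0//; exact: le_lt_trans y2r.
have eE : e = (K + 1) * (e / (2 * (K + 1))) + (K + 1) * (e / (2 * (K + 1))).
  by field; lra.
rewrite [leRHS]eE; apply: lerD; apply: ler_pM => //; lra.
Qed.

Lemma C1_space_of g (d : bool -> R * R -> R) :
  (forall b x, is_pd b g x (d b x)) -> (forall b, continuous (d b)) ->
  C1_space g /\ forall b, pd b g = d b.
Proof.
move=> gd dc; have [gp gE] := partials_of gd; split=> //; split=> //.
- apply: continuous_locally_bounded_partials => // x.
  have B b : exists2 r : R, 0 < r & forall y,
      `|y.1 - x.1| < r -> `|y.2 - x.2| < r -> `|pd b g y| <= `|d b x| + 1.
    have /continuous_planeP/(_ 1 ltr01)[r r0 rP] := dc b x.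
    exists r => // y y1 y2; rewrite gE -lerBlDl.
    by apply: le_trans (rP y y1 y2); rewrite lerB_dist.
  have [[r1 r10 P1] [r2 r20 P2]] := (B true, B false).
  exists (Num.max (`|d true x| + 1) (`|d false x| + 1)), (Num.min r1 r2).
  split=> [|b y]; rewrite !lt_min ?r10// => /andP[? ?] /andP[? ?].
  by rewrite le_max; case: b; [rewrite P1|rewrite P2 ?orbT].
- by rewrite -[dx1 g]/(pd true g) gE; exact: dc.
- by rewrite -[dx2 g]/(pd false g) gE; exact: dc.
Qed.

Lemma C1_spaceP g b x : C1_space g -> is_pd b g x (pd b g x).
Proof. by move=> [gp _ _ _]; exact: has_partialsP. Qed.

Lemma C1_space_pd_continuous g b : C1_space g -> continuous (pd b g).
Proof. by move=> [_ _ g1 g2]; case: b; [exact: g1|exact: g2]. Qed.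

End PlaneCalculus.
Arguments C1_space_pd_continuous {R g} b _ _ _.
Arguments C1_spaceP {R g} b x _.
Arguments has_partialsP {R g} b x _.

(** * Symmetry of second derivatives and the Poincare lemma *)

Section Potential.
Variable R : realType.
Implicit Types (x y : R * R) (g h A B : R * R -> R).

Lemma mixed_partials_commute g x :
  has_partials g -> C1_space (dx1 g) -> C1_space (dx2 g) ->
  dx1 (dx2 g) x = dx2 (dx1 g) x.
Proof.
move=> gp g1 g2; apply: (@is_pd_val _ true).
pose F (t s : R) := g (s, t).
apply: (@mixed_derivative _ F (fun t s => pd true g (s, t))
  (fun t s => pd false (dx1 g) (s, t)) (fun s => pd false g (s, x.2)) x.2) => /=.
- by move=> t s _; exact: (has_partialsP true (s, t)).
- by move=> t s _; exact: (C1_spaceP false (s, t)).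
- move=> t s; apply: continuous_subspaceT => r.
  have [_ d1] := C1_spaceP false (s, r) g1.
  by have [+ _] := C1_spaceP false (s, r) g1 =>
    /derivable1_diffP/differentiable_continuous.
- by move=> s; exact: (is_derive_right (has_partialsP false (s, x.2) gp)).
- move=> e e0.
  have /(_ x)/continuous_planeP/(_ e e0)[r r0 rP] :=
    C1_space_pd_continuous false g1.
  exists r => // t s t1 t2 s1; apply: rP => //=.
  by rewrite ger0_norm; lra.
Qed.

(** Compactness of the segment makes the modulus of continuity in the first
    variable uniform along it. *)
Lemma uniformly_continuous_strip h (a M e : R) : continuous h -> 0 < e ->
  exists2 d : R, 0 < d & forall k s, `|k| < d -> `|s| <= M ->
    `|h (a + k, s) - h (a, s)| <= e.
Proof.
move=> hc e0.
have := @segment_compact R (- M) M => /compact_near_coveringP.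
move=> /(_ R (nbhs (0 : R)) (fun k s => `|h (a + k, s) - h (a, s)| <= e) _).
have e20 : 0 < e / 2 by rewrite divr_gt0.
case=> [s _|d /= d0 dP].
  have /continuous_planeP/(_ _ e20)[r r0 rP] := hc (a, s).
  exists ([set s' | `|s' - s| < r], [set k | `|k| < r]).
    by split; exists r => // z /=; rewrite ?sub0r ?normrN // distrC.
  move=> [s' k] /= [s'r kr].
  have h1 : `|h (a + k, s') - h (a, s)| <= e / 2.
    by apply: rP => //=; rewrite addrC addKr.
  have h2 : `|h (a, s') - h (a, s)| <= e / 2.
    by apply: rP => //=; rewrite subrr normr0.
  rewrite (_ : _ - _ = (h (a + k, s') - h (a, s)) - (h (a, s') - h (a, s))).
    by apply: le_trans (ler_normB _ _) _; lra.
  by ring.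
exists d => // k s kd sM; apply: (dP k) => /=.
  by rewrite sub0r normrN.
by rewrite in_itv /= -ler_norml.
Qed.

(** Formally the derivative in s of the integral of B (s, .) is the integral of
    dx1 B = dx2 A, which is A x - A (x.1, 0).  The mean value theorem, once in
    each variable, stands in for differentiation under a signed integral. *)
Lemma is_derive_partial_primitive A B (Phi : R -> R -> R) :
  C1_space A -> C1_space B -> (forall x, dx2 A x = dx1 B x) ->
  (forall s, Phi s 0 = 0) ->
  (forall s t : R, is_derive t 1 (Phi s) (B (s, t))) ->
  forall x, is_derive x.1 1 (Phi ^~ x.2) (A x - A (x.1, 0)).
Proof.
move=> A1 B1 AB Phi0 dPhi [a z] /=; apply/is_derive_epsP => e e0.
have z10 : 0 < `|z| + 1 by rewrite ltr_wpDl.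
have e1 : 0 < e / (`|z| + 1) by exact: divr_gt0.
have [d d0 dP] := uniformly_continuous_strip a `|z|
  (C1_space_pd_continuous true B1) e1.
exists d => // k k0 kd.
have [|c] := @mean_value R
  (fun t => Phi (a + k) t - Phi a t - k * (A (a, t) - A (a, 0)))
  (fun t => B (a + k, t) - B (a, t) - k * (dx2 A (a, t) - 0)) 0 z.
  move=> c _; apply: is_deriveB.
  apply: is_deriveZ; apply: is_deriveB.
  exact: (C1_spaceP false (a, c)).
rewrite !Phi0 subr0 !subrr mulr0 !subr0 => cz E.
have [c' c'P E'] := @mean_value R (fun s => B (s, c)) (fun s => dx1 B (s, c))
  a (a + k) (fun s _ => C1_spaceP true (s, c) B1).
have -> : k^-1 * (Phi (a + k) z - Phi a z) - (A (a, z) - A (a, 0)) =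
   (dx1 B (a + (c' - a), c) - dx1 B (a, c)) * z.
  apply: (mulfI k0); rewrite mulrBr mulrA mulfV // mul1r E AB E'.
  by rewrite [a + (c' - a)]addrC subrK; ring.
rewrite normrM; apply: le_trans (ler_pM _ _ (dP (c' - a) c _ _) (lexx _)) _ => //.
  by apply: le_lt_trans c'P _; rewrite addrC addKr.
rewrite -[leRHS](@divfK _ (`|z| + 1)) ?gt_eqF //.
by apply: ler_wpM2l; [rewrite divr_ge0 // ltW|rewrite lerDl].
Qed.

(** The potential is the primitive of A along the axis x_2 = 0, continued
    vertically by the primitive of B. *)
Lemma poincare A B : C1_space A -> C1_space B ->
  (forall x, dx2 A x = dx1 B x) ->
  exists p, [/\ C1_space p, dx1 p = A & dx2 p = B].
Proof.
move=> A1 B1 AB.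
have [_ Ac _ _] := A1; have [_ Bc _ _] := B1.
have [|P [_ dP]] := @continuous_primitive R (fun s => A (s, 0)).
  exact: (@continuous_axis _ A true (0, 0) Ac).
have /choice[Q QP] : forall s : R, exists Q : R -> R,
    Q 0 = 0 /\ forall t : R, is_derive t 1 Q (B (s, t)).
  move=> s; apply: continuous_primitive.
  exact: (@continuous_axis _ B false (s, 0) Bc).
pose p x := P x.1 + Q x.1 x.2.
have [||p1 pE] := @C1_space_of _ p (fun b => if b then A else B).
- move=> [] x; rewrite /is_pd /=.
    rewrite -[A x](subrKC (A (x.1, 0))); apply: is_deriveD => //=.
    by apply: (is_derive_partial_primitive A1 B1 AB) => s; have [] := QP s.
  rewrite -[B x]add0r; apply: is_deriveD => /=; first exact: is_derive_cst.
  by have [_ /(_ x.2)] := QP x.1; rewrite -surjective_pairing.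
- by case.
- by exists p; split=> //; [exact: (pE true)|exact: (pE false)].
Qed.

End Potential.

(** * One-sided time derivatives *)

Section TimeDerivative.
Variable R : realType.
Implicit Types (x y : R * R) (f g : R -> R * R -> R) (t : R).

(** Steps to the right are admissible at every time t >= 0 and determine dt, so
    the initial time needs no separate treatment. *)
Lemma right_time_increments t : 0 <= t -> (0 : R)^'+ `=>` time_increments t.
Proof.
move=> t0 P; rewrite /time_increments /within /= => -[r /= r0 rP].
exists r => // h /= hr h0; apply: rP => //=; first by rewrite gt_eqF.
by rewrite addr_ge0 // ltW.
Qed.

Lemma time_increments_proper t : 0 <= t -> ProperFilter (time_increments t).
Proof.
move=> t0; split; last exact: within_filter.
by move=> /(right_time_increments t0); exact: filter_not_empty.
Qed.

Lemma is_derive_dt f t x : has_dt f -> 0 < t ->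
  is_derive t 1 (fun s => f s x) (dt f t x).
Proof.
move=> fd t0; apply/is_derive_epsP => e e0.
have /cvgrPdist_le/(_ e e0) := fd t x (ltW t0).
rewrite /time_increments /within /= => -[r /= r0 rP].
exists (Num.min r t); first by rewrite lt_min r0.
move=> k k0; rewrite lt_min => /andP[kr kt]; rewrite distrC; apply: rP => //=.
  by rewrite sub0r normrN.
by move: kt => /ltr_normlP[]; lra.
Qed.

Lemma cvg_right_dt f t x : has_dt f -> 0 <= t ->
  h^-1 * (f (t + h) x - f t x) @[h --> 0^'+] --> dt f t x.
Proof.
move=> fd t0; apply: cvg_trans (fd t x t0).
by apply: cvg_app; exact: right_time_increments.
Qed.

Lemma continuous_spacetimeP f t x : continuous_spacetime f -> 0 <= t ->
  forall e : R, 0 < e -> exists2 r : R, 0 < r & forall s y, 0 <= s ->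
    `|s - t| < r -> `|y.1 - x.1| < r -> `|y.2 - x.2| < r ->
    `|f s y - f t x| <= e.
Proof.
move=> /subspace_continuousP fc t0 e e0.
have /cvgrPdist_le/(_ e e0) := fc (t, x) t0.
rewrite /within /= => /nbhs_ballP[r /= r0 rP].
exists r => // s y s0 st y1 y2; rewrite distrC.
by apply: (rP (s, y)) => //; split; rewrite /ball /= ?[`|t - s|]distrC //;
  split; rewrite /ball /= distrC.
Qed.

Lemma continuous_spacetime_slice f t : continuous_spacetime f -> 0 <= t ->
  continuous (f t).
Proof.
move=> fc t0 x; apply/continuous_planeP => e e0.
have [r r0 rP] := continuous_spacetimeP x fc t0 e0.
by exists r => // y y1 y2; apply: rP => //; rewrite subrr normr0.
Qed.

Lemma is_pd_dt b f t x : C1_spacetime f -> C1_spacetime (fun s => pd b (f s)) ->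
  0 <= t -> is_pd b (dt f t) x (dt (fun s => pd b (f s)) t x).
Proof.
move=> [fd fp _ _ _] [gd _ gc gdc _] t0.
pose l := axis_point b x.
apply: (@mixed_derivative _ (fun r s => f r (l s)) (fun r s => pd b (f r) (l s))
  (fun r s => dt (fun r => pd b (f r)) r (l s)) _ t) => /=.
- move=> r s tr; have := has_partialsP b (l s) (fp _ (le_trans t0 tr)).
  by rewrite /is_pd coord_axis_point /l;
    under eq_fun do rewrite axis_point_idem.
- by move=> r s tr; apply: is_derive_dt => //; exact: le_lt_trans tr.
- move=> r s; apply/subspace_continuousP => z /=; rewrite in_itv /= => /andP[tz zr].
  apply/cvgrPdist_le => e e0.
  have [d d0 dP] := continuous_spacetimeP (l s) gc (le_trans t0 tz) e0.
  exists d => //= z' zz'; rewrite in_itv /= => /andP[tz' _]; rewrite distrC.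
  by apply: dP; rewrite ?subrr ?normr0 // ?(le_trans t0) // distrC.
- by move=> s; exact: cvg_right_dt.
- move=> e e0; have [r r0 rP] := continuous_spacetimeP x gdc t0 e0.
  exists r => // u s tu ur sr; apply: rP.
  + by rewrite (le_trans t0) // ltW.
  + by rewrite ger0_norm; lra.
  + by move: sr; rewrite /l; case: (b) => //=; rewrite subrr normr0.
  + by move: sr; rewrite /l; case: (b) => //=; rewrite subrr normr0.
Qed.

Lemma dt_eq f g t x : 0 <= t -> (forall s, 0 <= s -> f s = g s) ->
  dt f t x = dt g t x.
Proof.
move=> t0 fg; rewrite /dt; congr lim; apply/seteqP.
by split; apply: near_eq_cvg; rewrite near_withinE; near=> h => /= th;
  rewrite /time_quotient !fg.
Unshelve. all: by end_near. Qed.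

Lemma dtB f g t x : has_dt f -> has_dt g -> 0 <= t ->
  dt (fun s y => f s y - g s y) t x = dt f t x - dt g t x.
Proof.
move=> fd gd t0; have PF := time_increments_proper t0; apply/cvg_lim => //.
rewrite [X in X @ _ --> _](_ : _ = time_quotient f t x \- time_quotient g t x).
  by apply: cvgB; [exact: fd|exact: gd].
by apply/funext => h; rewrite /time_quotient /=; ring.
Qed.

End TimeDerivative.

(** * Integration over the plane *)

Section PlaneMeasure.
Variable R : realType.
Local Notation leb := (@lebesgue_measure R).
Local Notation mu2 := (@plane_measure R).
Implicit Types (x y : R * R) (f g h : R * R -> R).

Lemma open_plane_measurable (U : set (R * R)) : open U -> measurable U.
Proof.
move=> oU.
pose box (q : (rat * rat) * (rat * rat)) : set (R * R) :=
  `](ratr q.1.1 : R), (ratr q.1.2 : R)[%classic `*`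
  `](ratr q.2.1 : R), (ratr q.2.2 : R)[%classic.
pose F q := if `[< box q `<=` U >] then box q else set0.
have -> : U = \bigcup_q F q.
  apply/seteqP; split=> [x Ux|x [q _]]; last first.
    by rewrite /F; case: asboolP => // qU; exact: qU.
  have /nbhs_planeP[r r0 rP] : nbhs x U by apply: open_nbhs_nbhs.
  have bnd (z : R) : exists q : rat * rat, [/\ z - r < ratr q.1, ratr q.1 < z,
      z < ratr q.2 & ratr q.2 < z + r].
    have /rat_in_itvoo[a] : z - r < z by lra.
    rewrite in_itv /= => /andP[? ?].
    have /rat_in_itvoo[b] : z < z + r by lra.
    by rewrite in_itv /= => /andP[? ?]; exists (a, b).
  have [q1 [a1 a2 a3 a4]] := bnd x.1; have [q2 [b1 b2 b3 b4]] := bnd x.2.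
  exists (q1, q2) => //; rewrite /F asboolT.
    by split=> /=; rewrite in_itv /=; apply/andP.
  move=> y [/=]; rewrite !in_itv /= => /andP[? ?] /andP[? ?].
  by apply: rP; apply/ltr_normlP; split; lra.
apply: countable_bigcupT_measurable => // q.
by rewrite /F; case: asboolP => // _; apply: measurableX; exact: measurable_itv.
Qed.

Lemma continuous_plane_measurable f : continuous f -> measurable_fun setT f.
Proof.
move=> /continuousP cf; apply: (measurability _ (RGenOpens.measurableE R)).
move=> _ [_ [a [b ->] <-]]; rewrite setTI; apply: open_plane_measurable.
exact/cf/interval_open.
Qed.

Definition integrable2 f : Prop := mu2.-integrable setT (fun x => (f x)%:E).
Definition integral2 f : R := \int[mu2]_x f x.

Lemma integrable2_measurable f : integrable2 f -> measurable_fun setT f.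
Proof. by move/measurable_int/measurable_EFinP. Qed.

Lemma integrable2D f g :
  integrable2 f -> integrable2 g -> integrable2 (fun x => f x + g x).
Proof.
move=> fi gi; rewrite /integrable2; under eq_fun do rewrite EFinD.
exact: integrableD.
Qed.

Lemma integrable2Z (c : R) f : integrable2 f -> integrable2 (fun x => c * f x).
Proof.
move=> fi; rewrite /integrable2; under eq_fun do rewrite EFinM.
exact: integrableZl.
Qed.

Lemma integrable2N f : integrable2 f -> integrable2 (fun x => - f x).
Proof.
by move/(integrable2Z (-1)); congr integrable2; apply/funext => x; rewrite mulN1r.
Qed.

Lemma integrable2_norm f : integrable2 f -> integrable2 (fun x => `|f x|).
Proof. exact: integrable_norm. Qed.

Lemma integrable2_le f g : measurable_fun setT f -> integrable2 g ->
  (forall x, `|f x| <= g x) -> integrable2 f.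
Proof.
move=> mf gi fg; apply: le_integrable gi => //; first exact/measurable_EFinP.
by move=> x _; rewrite lee_fin; apply: le_trans (fg x) _; exact: ler_norm.
Qed.

Lemma integral2D f g : integrable2 f -> integrable2 g ->
  integral2 (fun x => f x + g x) = integral2 f + integral2 g.
Proof. by move=> fi gi; rewrite /integral2 RintegralD. Qed.

Lemma integral2Z (c : R) f : integrable2 f ->
  integral2 (fun x => c * f x) = c * integral2 f.
Proof. by move=> fi; rewrite /integral2 RintegralZl. Qed.

Lemma integral2N f : integrable2 f -> integral2 (fun x => - f x) = - integral2 f.
Proof.
move=> fi; rewrite -mulN1r -integral2Z //; congr integral2.
by apply/funext => x; rewrite mulN1r.
Qed.

Lemma integral2B f g : integrable2 f -> integrable2 g ->
  integral2 (fun x => f x - g x) = integral2 f - integral2 g.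
Proof. by move=> fi gi; rewrite integral2D ?integral2N //; exact: integrable2N. Qed.

Lemma ae_plane_sub (P Q : R * R -> Prop) : (forall x, P x -> Q x) ->
  {ae mu2, forall x, P x} -> {ae mu2, forall x, Q x}.
Proof. by move=> PQ; exact: (@filterS _ _ (ae_filter_ringOfSetsType mu2)). Qed.

Lemma ae_plane_and (P Q : R * R -> Prop) :
  {ae mu2, forall x, P x} -> {ae mu2, forall x, Q x} ->
  {ae mu2, forall x, P x /\ Q x}.
Proof. exact: (@filterI _ _ (ae_filter_ringOfSetsType mu2)). Qed.

Lemma integral2_ae_eq f g : integrable2 f -> measurable_fun setT g ->
  {ae mu2, forall x, f x = g x} -> integrable2 g /\ integral2 f = integral2 g.
Proof.
move=> fi mg fg.
have fgE : ae_eq mu2 setT (EFin \o f) (EFin \o g).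
  by apply: ae_plane_sub fg => x /= ->.
split; last first.
  rewrite /integral2 /Rintegral; congr fine; apply: ae_eq_integral => //.
    by apply/measurable_EFinP; exact: integrable2_measurable.
  exact/measurable_EFinP.
have mf := integrable2_measurable fi.
apply/integrableP; split; first exact/measurable_EFinP.
have /integrableP[_] := fi; congr (_ < _)%E.
apply: ae_eq_integral => //.
- by apply: measurableT_comp => //; exact/measurable_EFinP.
- by apply: measurableT_comp => //; exact/measurable_EFinP.
- by apply: ae_plane_sub fgE => x /= /(_ I) [E] _; rewrite E.
Qed.

Lemma oneDsqr_gt0 (s : R) : 0 < oneDsqr s.
Proof. exact: lt_le_trans (oneDsqr_ge1 s). Qed.

Lemma integrable_oneDsqrV : leb.-integrable setT (fun s : R => ((oneDsqr s)^-1)%:E).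
Proof.
have half : (\int[leb]_(x in `[0%R, +oo[) ((oneDsqr x)^-1)%:E < +oo)%E.
  by rewrite integral0y_oneDsqr ltry.
have mV : measurable_fun setT (fun s : R => (oneDsqr s)^-1).
  by apply: continuous_measurable_fun; exact: continuous_oneDsqrV.
apply/integrableP; split; first exact/measurable_EFinP.
under eq_integral => s _.
  rewrite gee0_abs; last by rewrite lee_fin invr_ge0 ltW // oneDsqr_gt0.
  over.
rewrite ge0_symfun_integralT //.
- by rewrite -set_itvcy lte_mul_pinfty // integral_ge0 // => s _;
    rewrite lee_fin invr_ge0 ltW // oneDsqr_gt0.
- exact: continuous_oneDsqrV.
- by move=> s; rewrite /= /oneDsqr sqrrN.
Qed.

End PlaneMeasure.

Section Decay.
Variable R : realType.
Local Notation leb := (@lebesgue_measure R).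
Local Notation mu2 := (@plane_measure R).
Implicit Types (x y : R * R) (f g h : R * R -> R).

(** A tensor product rather than a power of 1 + |x|: its integral is computed
    by Tonelli's theorem, and its restriction to a line is integrable with a
    bound independent of the line. *)
Definition weight x : R := (oneDsqr x.1 * oneDsqr x.2)^-1.

Lemma weight_gt0 x : 0 < weight x.
Proof. by rewrite invr_gt0 mulr_gt0 // oneDsqr_gt0. Qed.

Lemma oneDsqrV_ge0 (s : R) : 0 <= (oneDsqr s)^-1.
Proof. by rewrite invr_ge0 ltW // oneDsqr_gt0. Qed.

Lemma measurable_oneDsqrV : measurable_fun setT (fun s : R => (oneDsqr s)^-1).
Proof. by apply: continuous_measurable_fun; exact: continuous_oneDsqrV. Qed.

Lemma integrable2_weight : integrable2 weight.
Proof.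
have mV := measurable_oneDsqrV.
have mw : measurable_fun setT weight.
  rewrite (_ : weight = fun x => (oneDsqr x.1)^-1 * (oneDsqr x.2)^-1); last first.
    by apply/funext => x; rewrite /weight invfM.
  by apply: measurable_funM; [apply: (measurableT_comp mV)|apply: (measurableT_comp mV)].
have /integrableP[_ fin1] := @integrable_oneDsqrV R.
have intE : (\int[leb]_s `|((oneDsqr s)^-1)%:E| = \int[leb]_s ((oneDsqr s)^-1)%:E)%E.
  by apply: eq_integral => s _; rewrite gee0_abs // lee_fin oneDsqrV_ge0.
rewrite intE in fin1.
have fin1' : (0 <= \int[leb]_s ((oneDsqr s)^-1)%:E)%E.
  by apply: integral_ge0 => s _; rewrite lee_fin oneDsqrV_ge0.
apply/integrable12ltyP; first exact/measurable_EFinP.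
under eq_integral => s _.
  under eq_integral => t _.
    rewrite gee0_abs; last by rewrite lee_fin ltW // weight_gt0.
    rewrite /weight /= invfM EFinM.
    over.
  rewrite ge0_integralZl //; last exact/measurable_EFinP.
  over.
rewrite ge0_integralZr //; last exact/measurable_EFinP.
by apply: lte_mul_pinfty => //; rewrite ge0_fin_numE.
Qed.

Lemma integrable2_decay f (K : R) : measurable_fun setT f ->
  (forall x, `|f x| <= K * weight x) -> integrable2 f.
Proof. by move=> mf; apply: integrable2_le => //; exact/integrable2Z/integrable2_weight. Qed.

Lemma cvg_oneDsqrV_nat (a : R ^nat) : (forall n, n%:R <= `|a n|) ->
  (oneDsqr (a n))^-1 @[n --> \oo] --> 0.
Proof.
move=> an; apply: (@squeeze_cvgr _ _ _ _ (cst 0) (fun n => n.+1%:R^-1)).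
- apply: nearW => -[|n]; rewrite oneDsqrV_ge0 /=.
    by rewrite invr1 invf_le1 ?oneDsqr_gt0 // oneDsqr_ge1.
  rewrite lef_pV2 ?posrE ?oneDsqr_gt0 // /oneDsqr -real_normK ?num_real //.
  rewrite -natr1 addrC lerD2l; apply: le_trans (an n.+1) _.
  have : 1 <= `|a n.+1| by apply: le_trans (an n.+1); rewrite ler1n.
  by move=> a1; rewrite expr2 ler_peMl // ltW // (lt_le_trans ltr01).
- exact: cvg_cst.
- exact: cvg_harmonic.
Qed.

(** A primitive that decays at both ends gives a vanishing integral: integrate
    over the interval from -n to n and let n grow. *)
Lemma integral_derivative_eq0 (F F' : R -> R) (K : R) : continuous F' ->
  (forall s : R, is_derive s 1 F (F' s)) ->
  (forall s, `|F s| <= K * (oneDsqr s)^-1) ->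
  (forall s, `|F' s| <= K * (oneDsqr s)^-1) ->
  (\int[leb]_s (F' s)%:E = 0)%E.
Proof.
move=> cF' dF FK F'K.
have cF : continuous F.
  by move=> s; have [/derivable1_diffP/differentiable_continuous] := dF s.
pose I n : set R := `[- n.+1%:R, n.+1%:R]%classic.
have iK : leb.-integrable setT (fun s => (K * (oneDsqr s)^-1)%:E).
  by under eq_fun do rewrite EFinM; apply: integrableZl => //;
    exact: integrable_oneDsqrV.
have mF' : measurable_fun setT F' by exact: continuous_measurable_fun.
have [] := @dominated_convergence _ _ _ leb setT measurableT
  (fun n s => ((F' \_ (I n)) s)%:E) (fun s => (F' s)%:E)
  (fun s => (K * (oneDsqr s)^-1)%:E) _ _ _ iK.
- move=> n; apply/measurable_EFinP; apply/(measurable_restrictT _ _).1.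
    exact: measurable_itv.
  exact: measurable_funS mF'.
- exact/measurable_EFinP.
- apply/aeW => s _; apply: cvg_near_cst; near=> n.
  rewrite patchE mem_set // /I /= in_itv /= -ler_norml.
  apply: (@le_trans _ _ n%:R); last by rewrite ler_nat.
  by near: n; exact: nbhs_infty_ger.
- apply/aeW => s n _; rewrite lee_fin patchE; case: ifP => // _.
  by rewrite normr0; apply: le_trans (F'K s).
move=> _ _ cv.
have E n : (\int[leb]_s ((F' \_ (I n)) s)%:E = (F n.+1%:R - F (- n.+1%:R))%:E)%E.
  rewrite [LHS](_ : _ = \int[leb]_(s in I n) (F' s)%:E)%E; last first.
    by rewrite [RHS]integral_mkcond restrict_EFin.
  rewrite EFinB; apply: continuous_FTC2.
  - by rewrite gtrN.
  - exact: continuous_subspaceT.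
  - split=> [s _||]; first by have [] := dF s.
      by apply: cvg_at_right_filter; exact: cF.
    by apply: cvg_at_left_filter; exact: cF.
  - by move=> s _; rewrite derive1E; have [] := dF s.
rewrite (_ : (fun n => _) = (fun n => (F n.+1%:R - F (- n.+1%:R))%:E)) in cv; last first.
  by apply/funext => n; rewrite E.
apply: (cvg_unique _ cv) => //.
apply: cvg_EFin; first exact: nearW.
have F0 (a : R ^nat) : (forall n, n%:R <= `|a n|) -> F (a n) @[n --> \oo] --> 0.
  move=> an; apply: norm_cvg0.
  apply: (@squeeze_cvgr _ _ _ _ (cst 0) (fun n => K * (oneDsqr (a n))^-1)).
  - by apply: nearW => n; rewrite normr_ge0 FK.
  - exact: cvg_cst.
  - by rewrite -(mulr0 K); apply: cvgM; [exact: cvg_cst|exact: cvg_oneDsqrV_nat].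
rewrite -(subr0 0); apply: cvgB; apply: F0 => n.
  by rewrite ger0_norm // ler_nat.
by rewrite normrN ger0_norm // ler_nat.
Unshelve. all: by end_near. Qed.

(** Fubini's theorem and the vanishing on every line.  Applied to products this
    is integration by parts without boundary terms. *)
Lemma integral2_pd_eq0 b f (K : R) :
  (forall x, is_pd b f x (pd b f x)) -> continuous (pd b f) ->
  (forall x, `|f x| <= K * weight x) -> (forall x, `|pd b f x| <= K * weight x) ->
  integral2 (pd b f) = 0.
Proof.
move=> df cdf fK dfK.
have i2 : integrable2 (pd b f).
  by apply: (integrable2_decay (K := K)) => //; exact: continuous_plane_measurable.
have line x : (\int[leb]_s (pd b f (axis_point b x s))%:E = 0)%E.
  have K0 : 0 <= K.
    by rewrite -(pmulr_lge0 _ (weight_gt0 x)); exact: le_trans (fK x).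
  have wK s : K * weight (axis_point b x s) <= K * (oneDsqr s)^-1.
    apply: ler_wpM2l => //; rewrite /weight invfM.
    by case: (b) => /=; [rewrite ler_piMr|rewrite ler_piMl];
      rewrite ?oneDsqrV_ge0 // invf_le1 ?oneDsqr_gt0 // oneDsqr_ge1.
  apply: (@integral_derivative_eq0 (fun s => f (axis_point b x s)) _ K).
  - exact: continuous_axis.
  - move=> s; have := df (axis_point b x s); rewrite /is_pd coord_axis_point.
    by under eq_fun do rewrite axis_point_idem.
  - by move=> s; exact: le_trans (fK _) (wK s).
  - by move=> s; exact: le_trans (dfK _) (wK s).
rewrite /integral2 /Rintegral; case: b df cdf fK dfK i2 line => df cdf fK dfK i2 line.
- rewrite -(integral21_prod_meas1 i2) /fubini_G.
  by under eq_integral => t _ do rewrite (line (0, t)); rewrite integral0.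
- rewrite -(integral12_prod_meas1 i2) /fubini_F.
  by under eq_integral => t _ do rewrite (line (t, 0)); rewrite integral0.
Qed.

End Decay.

(** * Tempered and rapidly decreasing functions *)

Section RapidDecay.
Variable R : realType.
Implicit Types (x y : R * R) (f g h : R * R -> R) (b : bool).

Lemma dot_self x : dot x x = x.1 ^+ 2 + x.2 ^+ 2.
Proof. by rewrite /dot !expr2. Qed.

Lemma enorm_sqr x : enorm x ^+ 2 = x.1 ^+ 2 + x.2 ^+ 2.
Proof. by rewrite /enorm sqr_sqrtr dot_self // addr_ge0 // sqr_ge0. Qed.

Lemma enorm_ge0 x : 0 <= enorm x.
Proof. exact: sqrtr_ge0. Qed.

Lemma coord_le_enorm b x : `|coord b x| <= enorm x.
Proof.
rewrite -(@ler_pXn2r _ 2) ?nnegrE ?enorm_ge0 // enorm_sqr real_normK ?num_real //.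
by case: b; rewrite /coord ?lerDl ?lerDr sqr_ge0.
Qed.

Lemma enorm_le x : enorm x <= `|x.1| + `|x.2|.
Proof.
rewrite -(@ler_pXn2r _ 2) ?nnegrE ?enorm_ge0 ?addr_ge0 // enorm_sqr sqrrD.
rewrite !real_normK ?num_real // -addrA lerD2l lerDr.
by rewrite mulrn_wge0 // mulr_ge0.
Qed.

Lemma onePenorm_ge1 x : 1 <= 1 + enorm x.
Proof. by rewrite lerDl enorm_ge0. Qed.

Lemma onePenorm_gt0 x : 0 < 1 + enorm x.
Proof. exact: lt_le_trans (onePenorm_ge1 x). Qed.

(** Decay of order 4 in 1 + |x| is what the reference weight costs. *)
Lemma weightV_le x : oneDsqr x.1 * oneDsqr x.2 <= (1 + enorm x) ^+ 4.
Proof.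
have P b : oneDsqr (coord b x) <= (1 + enorm x) ^+ 2.
  rewrite /oneDsqr sqrrD expr1n mul1r -addrA lerD2l.
  apply: (@le_trans _ _ (enorm x ^+ 2)); last first.
    by rewrite lerDr mulrn_wge0 // enorm_ge0.
  by rewrite -real_normK ?num_real // ler_pXn2r ?nnegrE ?enorm_ge0 // coord_le_enorm.
rewrite -[4%N]/(2 + 2)%N exprD.
by apply: ler_pM; [exact/ltW/oneDsqr_gt0|exact/ltW/oneDsqr_gt0|exact: (P true)
  |exact: (P false)].
Qed.

Lemma continuous_enorm : continuous (@enorm R).
Proof.
move=> x; apply: (@continuous_comp _ _ _ (fun x => dot x x) (@Num.sqrt R));
  last exact: sqrt_continuous.
by apply: cvgD; apply: cvgM; (exact: cvg_fst || exact: cvg_snd).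
Qed.

Lemma continuous_onePenormX N : continuous (fun x : R * R => (1 + enorm x) ^+ N).
Proof.
move=> x; apply: (@continuous_comp _ _ _ (fun x => 1 + enorm x) (fun s : R => s ^+ N)).
  by apply: cvgD; [exact: cvg_cst|exact: continuous_enorm].
exact: exprn_continuous.
Qed.

Lemma measurable_onePenormX N :
  measurable_fun setT (fun x : R * R => (1 + enorm x) ^+ N).
Proof. by apply: continuous_plane_measurable; exact: continuous_onePenormX. Qed.

Lemma measurable_onePenormXV N :
  measurable_fun setT (fun x : R * R => ((1 + enorm x) ^+ N)^-1).
Proof.
apply: continuous_plane_measurable => x.
apply: cvgV; first by rewrite expf_neq0 // gt_eqF // onePenorm_gt0.
exact: continuous_onePenormX.
Qed.

Definition rapid f : Prop := forall N : nat, exists C : R, forall x,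
  (1 + enorm x) ^+ N * `|f x| <= C.

Lemma rapidW f g : (forall x, `|f x| <= `|g x|) -> rapid g -> rapid f.
Proof.
move=> fg gr N; have [C CP] := gr N; exists C => x; apply: le_trans (CP x).
by apply: ler_wpM2l => //; rewrite exprn_ge0 // ltW // onePenorm_gt0.
Qed.

Lemma rapidD f g : rapid f -> rapid g -> rapid (fun x => f x + g x).
Proof.
move=> fr gr N; have [C CP] := fr N; have [D DP] := gr N; exists (C + D) => x.
apply: le_trans (lerD (CP x) (DP x)); rewrite -mulrDr.
by apply: ler_wpM2l; [rewrite exprn_ge0 // ltW // onePenorm_gt0|exact: ler_normD].
Qed.

Lemma rapidZ (c : R) f : rapid f -> rapid (fun x => c * f x).
Proof.
move=> fr N; have [C CP] := fr N; exists (`|c| * C) => x.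
by rewrite normrM mulrCA ler_wpM2l.
Qed.

Lemma rapid_coord b f : rapid f -> rapid (fun x => coord b x * f x).
Proof.
move=> fr N; have [C CP] := fr N.+1; exists C => x; apply: le_trans (CP x).
rewrite normrM exprSr -mulrA ler_wpM2l ?exprn_ge0 ?(ltW (onePenorm_gt0 _)) //.
apply: ler_wpM2r => //; apply: le_trans (coord_le_enorm b x) _.
by rewrite lerDr.
Qed.

Lemma rapid_weight f (N : nat) : rapid f ->
  exists2 C : R, 0 <= C & forall x, (1 + enorm x) ^+ N * `|f x| <= C * weight x.
Proof.
move=> /(_ (N + 4)%N)[C CP]; exists C.
  by apply: le_trans (CP 0); rewrite mulr_ge0 ?exprn_ge0 // ltW ?onePenorm_gt0.
move=> x; rewrite ler_pdivlMr ?mulr_gt0 ?oneDsqr_gt0 //.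
apply: le_trans (CP x); rewrite mulrAC exprD ler_wpM2r // ler_wpM2l ?weightV_le //.
by rewrite exprn_ge0 // ltW // onePenorm_gt0.
Qed.

Lemma rapid_integrable f : measurable_fun setT f -> rapid f -> integrable2 f.
Proof.
move=> mf /(rapid_weight 0)[C _ CP]; apply: (integrable2_decay mf (K := C)) => x.
by have := CP x; rewrite expr0 mul1r.
Qed.

Lemma tempered_measurable g : tempered g -> measurable_fun setT g.
Proof.
move=> [N /integrable2_measurable mg].
rewrite (_ : g = fun x => g x / (1 + enorm x) ^+ N * (1 + enorm x) ^+ N); last first.
  by apply/funext => x; rewrite divfK // expf_neq0 // gt_eqF // onePenorm_gt0.
by apply: measurable_funM => //; exact: measurable_onePenormX.
Qed.

(** Domination by a power of 1 + |x| times an integrable function is the form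
    in which temperedness passes to sums and to products with coordinates. *)
Lemma temperedP g : tempered g <-> measurable_fun setT g /\
  exists N, exists h, integrable2 h /\
     forall x, `|g x| <= (1 + enorm x) ^+ N * h x.
Proof.
split=> [gt|[mg [N [h [hi gh]]]]].
  split; first exact: tempered_measurable.
  have [N gN] := gt; exists N, (fun x => `|g x / (1 + enorm x) ^+ N|).
  split; first exact: integrable2_norm.
  move=> x; rewrite normrM normfV [`|(_ + _) ^+ N|]ger0_norm; last first.
    by rewrite exprn_ge0 // ltW // onePenorm_gt0.
  by rewrite mulrC divfK // expf_neq0 // gt_eqF // onePenorm_gt0.
exists N; apply: (integrable2_le _ hi).
  by apply: measurable_funM => //; exact: measurable_onePenormXV.
move=> x; rewrite normrM normfV [`|(_ + _) ^+ N|]ger0_norm; last first.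
  by rewrite exprn_ge0 // ltW // onePenorm_gt0.
by rewrite ler_pdivrMr ?exprn_gt0 ?onePenorm_gt0 // mulrC.
Qed.

Lemma tempered_rapid_integrable g f : tempered g -> measurable_fun setT f ->
  rapid f -> integrable2 (fun x => g x * f x).
Proof.
move=> /temperedP[mg [N [h [hi gh]]]] mf fr; have [C CP] := fr N.
apply: (integrable2_le _ (integrable2Z C hi)); first exact: measurable_funM.
move=> x; rewrite normrM.
have h0 : 0 <= h x.
  have := le_trans (normr_ge0 _) (gh x).
  by rewrite pmulr_rge0 // exprn_gt0 // onePenorm_gt0.
apply: le_trans (ler_wpM2r (normr_ge0 _) (gh x)) _.
by rewrite mulrAC ler_wpM2r.
Qed.

Lemma tempered_bounded f (C : R) : measurable_fun setT f ->
  (forall x, `|f x| <= C) -> tempered f.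
Proof.
move=> mf fC; apply/temperedP; split=> //; exists 4%N, (fun x => C * weight x).
split; first exact/integrable2Z/integrable2_weight.
move=> x; have C0 : 0 <= C by exact: le_trans (fC x).
rewrite mulrCA; apply: le_trans (fC x) _; rewrite ler_peMr //.
by rewrite ler_pdivlMr ?mulr_gt0 ?oneDsqr_gt0 // mul1r weightV_le.
Qed.

Lemma temperedD f g : tempered f -> tempered g -> tempered (fun x => f x + g x).
Proof.
move=> /temperedP[mf [N [h [hi fh]]]] /temperedP[mg [M [k [ki gk]]]].
apply/temperedP; split; first exact: measurable_funD.
exists (N + M)%N, (fun x => `|h x| + `|k x|); split.
  by apply: integrable2D; exact: integrable2_norm.
move=> x; apply: le_trans (ler_normD _ _) _; rewrite mulrDr.
have w1 n : 1 <= (1 + enorm x) ^+ n by rewrite exprn_ege1 // onePenorm_ge1.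
have w0 n : 0 <= (1 + enorm x) ^+ n by exact: le_trans (w1 n).
apply: lerD.
- apply: le_trans (fh x) _; apply: ler_pM => //.
  + by have := le_trans (normr_ge0 _) (fh x); rewrite pmulr_rge0 // (lt_le_trans ltr01).
  + by rewrite exprD ler_peMr.
  + exact: ler_norm.
- apply: le_trans (gk x) _; apply: ler_pM => //.
  + by have := le_trans (normr_ge0 _) (gk x); rewrite pmulr_rge0 // (lt_le_trans ltr01).
  + by rewrite exprD ler_peMl.
  + exact: ler_norm.
Qed.

Lemma temperedZ (c : R) f : tempered f -> tempered (fun x => c * f x).
Proof.
move=> /temperedP[mf [N [h [hi fh]]]]; apply/temperedP; split.
  by apply: measurable_funM.
exists N, (fun x => `|c| * h x); split; first exact: integrable2Z.
by move=> x; rewrite normrM mulrCA ler_wpM2l.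
Qed.

Lemma measurable_coord b : measurable_fun setT (@coord R b).
Proof. by case: b; [exact: measurable_fst|exact: measurable_snd]. Qed.

Lemma tempered_coord b f : tempered f -> tempered (fun x => coord b x * f x).
Proof.
move=> /temperedP[mf [N [h [hi fh]]]]; apply/temperedP; split.
  by apply: measurable_funM => //; exact: measurable_coord.
exists N.+1, h; split=> // x; rewrite normrM exprS -mulrA; apply: ler_pM => //.
by apply: le_trans (coord_le_enorm b x) _; rewrite lerDr.
Qed.

(** The two rates are independent so that the Gaussians separate the
    coordinates: their powers and products give all rectangles. *)
Definition gaussian (a : R * R) (y x : R * R) : R :=
  expR (- (a.1 * (x.1 - y.1) ^+ 2 + a.2 * (x.2 - y.2) ^+ 2)).

Let gauss1_bound (N : nat) (a z : R) : 0 < a -> exists2 C : R, 0 < C &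
  forall s, (1 + `|s|) ^+ N * expR (- (a * (s - z) ^+ 2)) <= C.
Proof.
(* The rate a is shared among the N factors 1 + |s|, with one share to spare. *)
move=> a0; pose e := a / N.+1%:R; have e0 : 0 < e by rewrite divr_gt0.
pose C := (1 + `|z|) * (2 + e^-1).
have C0 : 0 < C.
  by rewrite mulr_gt0 // ltr_wpDr ?addr_gt0 ?invr_ge0 // ltW.
exists (C ^+ N); first by rewrite exprn_gt0.
move=> s; set r := s - z.
have h : 1 + `|s| <= C * expR (e * r ^+ 2).
  apply: (@le_trans _ _ (C * (1 + e * r ^+ 2))); last first.
    by rewrite ler_pM2l // expR_ge1Dx.
  rewrite /C -mulrA.
  have -> : (2 + e^-1) * (1 + e * r ^+ 2) = 2 + e^-1 + 2 * e * r ^+ 2 + r ^+ 2.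
    by field; rewrite gt_eqF.
  have h1 : 1 + `|s| <= (1 + `|z|) * (1 + `|r|).
    rewrite mulrDl mul1r mulrDr mulr1 -addrA lerD2l.
    have : `|s| <= `|r| + `|z|.
      by rewrite -[s in leLHS](subrK z); exact: ler_normD.
    have : 0 <= `|z| * `|r| by rewrite mulr_ge0.
    lra.
  apply: le_trans h1 _; apply: ler_wpM2l; first by rewrite addr_ge0.
  have : 0 <= (`|r| - 1) ^+ 2 by rewrite sqr_ge0.
  rewrite sqrrB real_normK ?num_real // expr1n mulr1.
  have : 0 <= 2 * e * r ^+ 2 by rewrite mulr_ge0 ?sqr_ge0 // mulr_ge0 // ltW.
  have : 0 < e^-1 by rewrite invr_gt0.
  have : 0 <= r ^+ 2 by rewrite sqr_ge0.
  have : 0 <= `|r| by [].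
  move: (`|r|) => q; move: (r ^+ 2) => q2; rewrite mulr2n; lra.
have hN : (1 + `|s|) ^+ N <= (C * expR (e * r ^+ 2)) ^+ N.
  by rewrite lerXn2r // nnegrE ?addr_ge0 // mulr_ge0 ?expR_ge0 // ltW.
apply: le_trans (ler_wpM2r (expR_ge0 _) hN) _.
rewrite exprMn -expRM_natl -mulrA -expRD ler_piMr ?exprn_ge0 ?(ltW C0) //.
rewrite -[leRHS]expR0 ler_expR.
have : N%:R * (e * r ^+ 2) <= N.+1%:R * (e * r ^+ 2).
  by apply: ler_wpM2r; rewrite ?ler_nat // mulr_ge0 ?sqr_ge0 ?(ltW e0).
have -> : N.+1%:R * (e * r ^+ 2) = a * r ^+ 2.
  by rewrite mulrA /e [N.+1%:R * _]mulrC divfK ?pnatr_eq0.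
by lra.
Qed.

Lemma gaussian_rapid (a y : R * R) : 0 < a.1 -> 0 < a.2 -> rapid (gaussian a y).
Proof.
move=> a1 a2 N; have [C C0 CP] := gauss1_bound N y.1 a1.
have [D D0 DP] := gauss1_bound N y.2 a2; exists (C * D) => x.
rewrite ger0_norm ?expR_ge0 // /gaussian opprD expRD.
apply: (@le_trans _ _ (((1 + `|x.1|) * (1 + `|x.2|)) ^+ N *
   (expR (- (a.1 * (x.1 - y.1) ^+ 2)) * expR (- (a.2 * (x.2 - y.2) ^+ 2))))).
  apply: ler_wpM2r; first by rewrite mulr_ge0 ?expR_ge0.
  rewrite lerXn2r // ?nnegrE ?(ltW (onePenorm_gt0 _)) ?mulr_ge0 ?addr_ge0 //.
  apply: (@le_trans _ _ (1 + (`|x.1| + `|x.2|))); first by rewrite lerD2l enorm_le.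
  have : 0 <= `|x.1| * `|x.2| by rewrite mulr_ge0.
  lra.
by rewrite exprMn mulrACA; apply: ler_pM; rewrite ?CP ?DP // mulr_ge0 ?expR_ge0 ?exprn_ge0 // addr_ge0.
Qed.

Lemma is_pd_gaussian b (a y x : R * R) :
  is_pd b (gaussian a y) x (- (2 * coord b a * (coord b x - coord b y)) * gaussian a y x).
Proof.
rewrite mulrC; apply: (@is_pd_comp _ b
   (fun x => - (a.1 * (x.1 - y.1) ^+ 2 + a.2 * (x.2 - y.2) ^+ 2)) _ _ expR).
have sq b' : is_pd b (fun x => coord b' a * (coord b' x - coord b' y) ^+ 2) x
    (coord b' a * (((b == b')%:R - 0) * (coord b' x - coord b' y)
                   + (coord b' x - coord b' y) * ((b == b')%:R - 0))).
  apply: is_pdZ; rewrite -[X in is_pd _ X]/(fun x => _).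
  have -> : (fun x => (coord b' x - coord b' y) ^+ 2) =
            (fun x => (coord b' x - coord b' y) * (coord b' x - coord b' y)).
    by apply/funext => z; rewrite expr2.
  by apply: is_pdM; apply: is_pdB; (exact: is_pd_coord || exact: is_pd_cst).
have := is_pdN (is_pdD (sq true) (sq false)).
by congr is_pd; case: b {sq} => /=; ring.
Qed.

Lemma measurable_gaussian (a y : R * R) : measurable_fun setT (gaussian a y).
Proof.
apply: (measurableT_comp (@measurable_expR R)).
apply: measurableT_comp => //; apply: measurable_funD; apply: measurable_funM => //;
  by apply: measurable_funX; apply: measurable_funB.
Qed.

End RapidDecay.

(** * Gaussians separate tempered functions *)

Section Separation.
Variable R : realType.
Local Notation mu2 := (@plane_measure R).
Local Notation plane := (measurableTypeR R * measurableTypeR R)%type.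
Implicit Types (x y a : R * R) (f g h : R * R -> R).

Definition closed_box (p : (R * R) * (R * R)) : set (R * R) :=
  `[p.1.1, p.1.2]%classic `*` `[p.2.1, p.2.2]%classic.

Lemma closed_box_measurable p : measurable (closed_box p : set plane).
Proof. by apply: measurableX; exact: measurable_itv. Qed.

Lemma closed_box_setI : setI_closed (range closed_box).
Proof.
move=> _ _ [p _ <-] [q _ <-].
exists ((Num.max p.1.1 q.1.1, Num.min p.1.2 q.1.2),
        (Num.max p.2.1 q.2.1, Num.min p.2.2 q.2.2)) => //.
apply/seteqP; split=> x; rewrite /closed_box /= !in_itv /= !ge_max !le_min.
  by move=> [/andP[/andP[? ?] /andP[? ?]] /andP[/andP[? ?] /andP[? ?]]];
    split; split; apply/andP.
by move=> [[/andP[-> ->] /andP[-> ->]] [/andP[-> ->] /andP[-> ->]]].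
Qed.

Lemma le_archi_nat (s : R) : exists n : nat, `|s| <= n%:R.
Proof.
by exists (Num.bound `|s|); apply/ltW/archi_boundP.
Qed.

(** Half-planes, which are countable unions of boxes, generate the product
    sigma-algebra. *)
Lemma closed_box_generates :
  @measurable _ plane = <<s range closed_box >>.
Proof.
apply/seteqP; split; last first.
  apply: smallest_sub; first exact: sigma_algebra_measurable.
  by move=> _ [p _ <-]; exact: closed_box_measurable.
pose T := g_sigma_algebraType (range closed_box).
have bnd (a : R) (s t : R) : a <= s -> exists n : nat, [/\ s <= n%:R, - n%:R <= t & t <= n%:R].
  move=> _; have [n nP] := le_archi_nat (`|s| + `|t|); exists n.
  rewrite ger0_norm ?addr_ge0 // in nP.
  have := ler_norm s; have := ler_norm t; have := ler_norm (- t).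
  by rewrite normrN; have := normr_ge0 s; have := normr_ge0 t; split; lra.
have mfst : measurable_fun setT (fst : T -> R).
  apply: (measurability _ (RGenCInfty.measurableE R)).
  move=> _ [_ [a ->] <-]; rewrite setTI.
  rewrite (_ : _ @^-1` _ = \bigcup_n closed_box ((a, n%:R), (- n%:R, n%:R))).
    by apply: bigcupT_measurable => n; apply: sub_sigma_algebra; eexists.
  apply/seteqP; split=> [[s t]|[s t] [n _]]; rewrite /closed_box /= !in_itv /= ?andbT.
    move=> sa; have [n [n1 n2 n3]] := bnd a s t sa; exists n => //.
    by rewrite /= !in_itv /= sa n1 n2 n3.
  by move=> [/andP[]].
have msnd : measurable_fun setT (snd : T -> R).
  apply: (measurability _ (RGenCInfty.measurableE R)).
  move=> _ [_ [a ->] <-]; rewrite setTI.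
  rewrite (_ : _ @^-1` _ = \bigcup_n closed_box ((- n%:R, n%:R), (a, n%:R))).
    by apply: bigcupT_measurable => n; apply: sub_sigma_algebra; eexists.
  apply/seteqP; split=> [[s t]|[s t] [n _]]; rewrite /closed_box /= !in_itv /= ?andbT.
    move=> sa; have [n [n1 n2 n3]] := bnd a t s sa; exists n => //.
    by rewrite /= !in_itv /= sa n1 n2 n3.
  by move=> [_ /andP[]].
rewrite measurable_prod_measurableType.
apply: smallest_sub; first exact: smallest_sigma_algebra.
move=> _ [A mA] [B mB] <-.
have := measurableI _ _ (mfst measurableT A mA) (msnd measurableT B mB).
by rewrite !setTI; congr (_ _); apply/seteqP; split=> [] [s t].
Qed.

(** Inside a fixed large box the sets over which g integrates to 0 form a Dynkin
    system; it contains the boxes, which are stable under intersection, hence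
    all measurable sets. *)
Lemma ae_eq0_of_closed_boxes g : measurable_fun setT g ->
  (forall p, mu2.-integrable (closed_box p) (EFin \o g)) ->
  (forall p, (\int[mu2]_(x in closed_box p) (g x)%:E = 0)%E) ->
  {ae mu2, forall x, g x = 0}.
Proof.
move=> mg gi g0.
pose Q n := closed_box ((- n%:R, n%:R), (- n%:R, n%:R)).
have mQ n : measurable (Q n : set plane) by exact: closed_box_measurable.
suff H n : {ae mu2, forall x, Q n x -> g x = 0}.
  have := ae_foralln H; apply: ae_plane_sub => x gx.
  have [n nP] := le_archi_nat (`|x.1| + `|x.2|); apply: (gx n).
  rewrite ger0_norm ?addr_ge0 // in nP.
  by split; rewrite /= in_itv /= -ler_norml (le_trans _ nP) // ?lerDl ?lerDr.
pose h := (EFin \o g) \_ (Q n).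
have hi : mu2.-integrable setT h.
  exact: (@integrable_mkcond _ _ _ mu2 (Q n) (EFin \o g) (mQ n)).1 (gi _).
have hA (S : set plane) : measurable S -> mu2.-integrable S h.
  by move=> mS; apply: integrableS hi.
have P (S : set plane) : <<s range closed_box >> S -> (\int[mu2]_(x in S) h x = 0)%E.
  apply: (@dynkin_induction _ _ _ (fun S => \int[mu2]_(x in S) h x = 0)%E
    closed_box_generates closed_box_setI).
  - by rewrite -integral_mkcond; exact: g0.
  - move=> _ [p _ <-]; rewrite -integral_mkcondr.
    have [q _ <-] : range closed_box (closed_box p `&` Q n).
      by apply: closed_box_setI; eexists.
    exact: g0.
  - move=> A mA A0.
    have := @integral_setU _ _ _ mu2 A (~` A) h mA (measurableC mA) _ _.
    rewrite setUv -integral_mkcond g0 A0 add0e => -> //.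
      exact: measurable_int hi.
    by rewrite disj_set2E setICr.
  - move=> F mF tF F0; rewrite integral_bigcup //; last first.
      exact/hA/bigcupT_measurable.
    by rewrite eseries0 // => i _ _; exact: F0.
have : ae_eq mu2 setT h (cst 0%E).
  apply: integral_ae_eq => // E _ mE; rewrite integral0 P //.
  by rewrite -closed_box_generates.
apply: ae_plane_sub => x /(_ I) + Qx.
by rewrite /h patchE mem_set //= => -[].
Qed.

End Separation.

Section Bump.
Variable R : realType.
Implicit Types (E x z : R).

(** On [0, 1] these polynomials converge to the indicator of E >= 1/2, and they
    have no constant term: evaluated at a Gaussian they are combinations of
    Gaussians that converge to the indicator of an interval.  The exponent is
    chosen so that (m 2^m) E^m = m (2 E)^m tends to 0 for E < 1/2 and to
    infinity for E >= 1/2, the threshold included. *)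
Definition bump (m : nat) : {poly R} := 1 - (1 - 'X^m) ^+ (m * 2 ^ m).

Lemma bumpE m E : (bump m).[E] = 1 - (1 - E ^+ m) ^+ (m * 2 ^ m).
Proof. by rewrite /bump !hornerE. Qed.

Lemma bump_coef0 m : (bump m.+1)`_0 = 0.
Proof. by rewrite -horner_coef0 bumpE expr0n subr0 expr1n subrr. Qed.

Lemma bernoulli_sub x N : 0 <= x -> x <= 1 -> 1 - N%:R * x <= (1 - x) ^+ N.
Proof.
move=> x0 x1; elim: N => [|N IH]; first by rewrite mul0r subr0.
rewrite exprS; apply: le_trans (ler_wpM2l _ IH); last by rewrite subr_ge0.
have : 0 <= N%:R * x * x by rewrite !mulr_ge0.
by rewrite -natr1; move: (N%:R) => n; nra.
Qed.

Lemma bernoulli_add x N : 0 <= x -> 1 + N%:R * x <= (1 + x) ^+ N.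
Proof.
move=> x0; elim: N => [|N IH]; first by rewrite mul0r addr0.
rewrite exprS; apply: le_trans (ler_wpM2l _ IH); last by rewrite addr_ge0.
have : 0 <= N%:R * x * x by rewrite !mulr_ge0.
by rewrite -natr1; move: (N%:R) => n; nra.
Qed.

Lemma pow_sub_le x N : 0 <= x -> x <= 1 -> (1 - x) ^+ N <= (1 + N%:R * x)^-1.
Proof.
move=> x0 x1; have p0 : 0 < 1 + N%:R * x by rewrite ltr_wpDr // mulr_ge0.
rewrite -[leRHS]mul1r ler_pdivlMr //.
apply: (@le_trans _ _ ((1 - x) ^+ N * (1 + x) ^+ N)).
  by rewrite ler_wpM2l ?bernoulli_add // exprn_ge0 // subr_ge0.
rewrite -exprMn exprn_ile1 //.
  by rewrite mulr_ge0 ?subr_ge0 // addr_ge0.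
by rewrite -subr_sqr expr1n lerBlDr lerDl sqr_ge0.
Qed.

Lemma bump_exponent m E : (m * 2 ^ m)%:R * E ^+ m = m%:R * (2 * E) ^+ m.
Proof. by rewrite natrM natrX exprMn mulrA. Qed.

Lemma bump_itv m E : 0 <= E -> E <= 1 -> 0 <= (bump m).[E] <= 1.
Proof.
move=> E0 E1; rewrite bumpE; have := exprn_ge0 m E0; have := exprn_ile1 m E0 E1.
move: (E ^+ m) => z z1 z0.
rewrite subr_ge0 lerBlDr lerDl exprn_ile1 ?subr_ge0 // ?exprn_ge0 ?subr_ge0 //.
by rewrite lerBlDr lerDl.
Qed.

Lemma bump_le_geometric m E : 0 <= E -> E <= 1 ->
  (bump m).[E] <= m%:R * (2 * E) ^+ m.
Proof.
move=> E0 E1; rewrite bumpE -bump_exponent lerBlDr -lerBlDl.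
by apply: bernoulli_sub; [exact: exprn_ge0|exact: exprn_ile1].
Qed.

(** The linear bound, uniform in m, is what dominated convergence needs: a
    single Gaussian then dominates all the approximations. *)
Lemma bump_le m E : 0 <= E -> E <= 1 -> (bump m.+1).[E] <= 4 * E.
Proof.
move=> E0 E1; have [E4|E4] := leP E 4^-1; last first.
  have /andP[_ b1] := bump_itv m.+1 E0 E1; lra.
apply: le_trans (bump_le_geometric m.+1 E0 E1) _.
rewrite exprS mulrCA.
have h : m.+1%:R * (2 * E) ^+ m <= 1.
  have : (2 * E) ^+ m <= 2^-1 ^+ m.
    by apply: lerXn2r; rewrite ?nnegrE; lra.
  move=> /(ler_wpM2l (ler0n R m.+1)) h; apply: le_trans h _.
  by rewrite exprVn ler_pdivrMr ?exprn_gt0 // mul1r -natrX ler_nat ltn_expl.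
have : 2 * E * (m.+1%:R * (2 * E) ^+ m) <= 2 * E * 1.
  by apply: ler_wpM2l => //; lra.
by move: (2 * E * (_ * _)) => t; lra.
Qed.

Lemma cvg_bump1 E : 2^-1 <= E -> E <= 1 -> (bump m.+1).[E] @[m --> \oo] --> (1 : R).
Proof.
move=> E2 E1; have E0 : 0 <= E by lra.
rewrite -[1 in X in _ --> X]subr0.
rewrite (_ : (fun m => _) = fun m => 1 - (1 - E ^+ m.+1) ^+ (m.+1 * 2 ^ m.+1)); last first.
  by apply/funext => m; rewrite bumpE.
apply: cvgB; first exact: cvg_cst.
apply: (@squeeze_cvgr _ _ _ _ (cst 0) (fun n => n.+1%:R^-1)).
- apply: nearW => m /=.
  rewrite exprn_ge0 ?subr_ge0 ?exprn_ile1 //=.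
  apply: le_trans (pow_sub_le _ (exprn_ge0 _ E0) (exprn_ile1 _ E0 E1)) _.
  rewrite bump_exponent lef_pV2 ?posrE //; last first.
    by rewrite ltr_wpDr // mulr_ge0 // exprn_ge0 // mulr_ge0.
  rewrite -[leLHS]add0r lerD // ler_peMr // exprn_ege1 //; lra.
- exact: cvg_cst.
- exact: cvg_harmonic.
Qed.

(** Bernoulli's inequality for the square root of z leaves a geometric factor. *)
Lemma cvg_natM_geometric z : 0 <= z -> z < 1 -> n%:R * z ^+ n @[n --> \oo] --> (0 : R).
Proof.
move=> z0 z1; pose q := Num.sqrt z; pose d := 1 - q.
have q0 : 0 <= q by exact: sqrtr_ge0.
have q1 : q < 1 by rewrite -sqrtr1 ltr_sqrt.
have d0 : 0 < d by rewrite subr_gt0.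
have qz : z = q * q by rewrite -expr2 sqr_sqrtr.
apply: (@squeeze_cvgr _ _ _ _ (cst 0) (fun n => d^-1 * q ^+ n)).
- apply: nearW => n /=; rewrite mulr_ge0 ?exprn_ge0 //=.
  rewrite {1}qz exprMn mulrA ler_wpM2r ?exprn_ge0 //.
  have d1 : d <= 1 by rewrite lerBlDr lerDl.
  have := pow_sub_le n (ltW d0) d1; rewrite {1}/d subKr => h.
  apply: le_trans (ler_wpM2l (ler0n R n) h) _.
  rewrite ler_pdivrMr; last by rewrite ltr_wpDr // mulr_ge0 // ltW.
  rewrite mulrDr mulr1 [n%:R * d]mulrC mulKf ?gt_eqF // lerDr invr_ge0 ltW //.
- exact: cvg_cst.
- rewrite -(mulr0 d^-1); apply: cvgM; first exact: cvg_cst.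
  by apply: cvg_expr; rewrite ger0_norm.
Qed.

Lemma cvg_bump0 E : 0 <= E -> E < 2^-1 -> (bump m.+1).[E] @[m --> \oo] --> (0 : R).
Proof.
move=> E0 E2; have E1 : E <= 1 by lra.
apply: (@squeeze_cvgr _ _ _ _ (cst 0) (fun n => n.+1%:R * (2 * E) ^+ n.+1)).
- apply: nearW => m /=; rewrite bump_le_geometric // andbT.
  by have /andP[] := bump_itv m.+1 E0 E1.
- exact: cvg_cst.
- by rewrite (cvg_shiftS (fun n => n%:R * (2 * E) ^+ n)); apply: cvg_natM_geometric; lra.
Qed.

End Bump.

Section GaussianSeparation.
Variable R : realType.
Local Notation mu2 := (@plane_measure R).
Local Notation plane := (measurableTypeR R * measurableTypeR R)%type.
Implicit Types (x y a : R * R) (f g h : R * R -> R).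

Let vanishing g h : Prop :=
  integrable2 (fun x => g x * h x) /\ integral2 (fun x => g x * h x) = 0.

Let vanishing_eq g h k : h =1 k -> vanishing g h -> vanishing g k.
Proof. by move=> /funext ->. Qed.

Let vanishingD g h k : vanishing g h -> vanishing g k ->
  vanishing g (fun x => h x + k x).
Proof.
move=> [hi h0] [ki k0]; rewrite /vanishing; under eq_fun do rewrite mulrDr.
by split; [exact: integrable2D|rewrite integral2D // h0 k0 addr0].
Qed.

Let vanishingZ g h (c : R) : vanishing g h -> vanishing g (fun x => c * h x).
Proof.
move=> [hi h0]; rewrite /vanishing; under eq_fun do rewrite mulrCA.
by split; [exact: integrable2Z|rewrite integral2Z // h0 mulr0].
Qed.

Let vanishing0 g : vanishing g (fun=> 0).
Proof.
rewrite /vanishing; under eq_fun do rewrite mulr0.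
split; first exact: integrable0.
by rewrite /integral2 /Rintegral integral0.
Qed.

Let vanishing_sum g n (F : 'I_n -> R * R -> R) : (forall i, vanishing g (F i)) ->
  vanishing g (fun x => \sum_(i < n) F i x).
Proof.
elim: n F => [|n IH] F FP.
  by apply: vanishing_eq (vanishing0 g) => x; rewrite big_ord0.
apply: (@vanishing_eq _ (fun x => \sum_(i < n) F (widen_ord (leqnSn n) i) x + F ord_max x)).
  by move=> x; rewrite big_ord_recr.
by apply: vanishingD => //; apply: IH.
Qed.

Let gauss1 (c z s : R) : R := expR (- (c * (s - z) ^+ 2)).

Let gauss1_itv c z s : 0 < c -> 0 <= gauss1 c z s <= 1.
Proof.
move=> c0; rewrite expR_ge0 -[leRHS]expR0 ler_expR oppr_le0.
by rewrite mulr_ge0 ?sqr_ge0 // ltW.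
Qed.

Let gauss1X c y x i j :
  gauss1 c.1 y.1 x.1 ^+ i * gauss1 c.2 y.2 x.2 ^+ j =
  gaussian (i%:R * c.1, j%:R * c.2) y x.
Proof.
by rewrite /gauss1 -!expRM_natl -expRD /gaussian; congr expR => /=; ring.
Qed.

Let vanishing_poly g c y (p q : {poly R}) : 0 < c.1 -> 0 < c.2 ->
  (forall a z, 0 < a.1 -> 0 < a.2 -> vanishing g (gaussian a z)) ->
  p`_0 = 0 -> q`_0 = 0 ->
  vanishing g (fun x => p.[gauss1 c.1 y.1 x.1] * q.[gauss1 c.2 y.2 x.2]).
Proof.
move=> c1 c2 gv p0 q0.
apply: (@vanishing_eq _ (fun x => \sum_(i < size p) \sum_(j < size q)
    (p`_i * q`_j) * gaussian (i%:R * c.1, j%:R * c.2) y x)).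
  move=> x; rewrite !horner_coef big_distrl /=; apply: eq_bigr => i _.
  by rewrite big_distrr /=; apply: eq_bigr => j _; rewrite -gauss1X; ring.
apply: vanishing_sum => i; apply: vanishing_sum => j.
case: (nat_of_ord i) => [|{}i]; first by rewrite p0 mul0r; under eq_fun do rewrite mul0r.
case: (nat_of_ord j) => [|{}j]; first by rewrite q0 mulr0; under eq_fun do rewrite mul0r.
by apply/vanishingZ/gv; rewrite /= mulr_gt0.
Qed.

Let mem_itv_gauss1 (s1 s2 s : R) : s1 < s2 ->
  let r := (s2 - s1) / 2 in
  (s \in `[s1, s2]) = (2^-1 <= gauss1 (ln 2 / r ^+ 2) ((s1 + s2) / 2) s).
Proof.
move=> s12 r; have r0 : 0 < r by rewrite divr_gt0 ?subr_gt0.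
have {1}-> : 2^-1 = expR (- ln 2) :> R by rewrite expRN lnK // posrE.
rewrite /gauss1 ler_expR lerN2 mulrAC ler_pdivrMr ?exprn_gt0 //.
rewrite ler_pM2l; last by rewrite ln_gt0 // ltr1n.
rewrite -[X in X <= _](@real_normK _ _) ?num_real // ler_pXn2r ?nnegrE ?(ltW r0) //.
rewrite in_itv /= ler_norml /r.
by apply/andP/andP => -[? ?]; split; lra.
Qed.

(** The integral of g over a rectangle is the limit of its integrals against
    the product of two bump polynomials, one in a Gaussian of each variable;
    these are linear combinations of integrals against Gaussians. *)
Lemma gaussian_separation g : tempered g ->
  (forall a y, 0 < a.1 -> 0 < a.2 -> integral2 (fun x => g x * gaussian a y x) = 0) ->
  {ae mu2, forall x, g x = 0}.
Proof.
move=> gt g0; have mg := tempered_measurable gt.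
have gv a y : 0 < a.1 -> 0 < a.2 -> vanishing g (gaussian a y).
  move=> a1 a2; split; last exact: g0.
  by apply: tempered_rapid_integrable => //;
    [exact: measurable_gaussian|exact: gaussian_rapid].
suff H p : mu2.-integrable (closed_box p) (EFin \o g) /\
           (\int[mu2]_(x in closed_box p) (g x)%:E = 0)%E.
  by apply: ae_eq0_of_closed_boxes => // p; have [] := H p.
have mB : measurable (closed_box p : set plane) by exact: closed_box_measurable.
have [/andP[p1 p2]|degenerate] := boolP ((p.1.1 < p.1.2) && (p.2.1 < p.2.2)); last first.
  (* Degenerate boxes arise as intersections; they are null sets. *)
  have B0 : mu2 (closed_box p) = 0%E.
    transitivity (lebesgue_measure `[p.1.1, p.1.2]%classic *
                  lebesgue_measure `[p.2.1, p.2.2]%classic)%E.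
      by apply: product_measure1E; exact: measurable_itv.
    rewrite !lebesgue_measure_itv /= !lte_fin.
    by move: degenerate; rewrite negb_and => /orP[] /negbTE ->; rewrite ?mul0e ?mule0.
  have mgB : measurable_fun (closed_box p : set plane) (EFin \o g).
    by apply/measurable_EFinP; exact: measurable_funS mg.
  by split; [exact: null_set_integrable|exact: null_set_integral].
(* The rates put the Gaussians at height 1/2 on the sides of the box. *)
pose r1 := (p.1.2 - p.1.1) / 2; pose r2 := (p.2.2 - p.2.1) / 2.
pose y := ((p.1.1 + p.1.2) / 2, (p.2.1 + p.2.2) / 2).
pose c := (ln 2 / r1 ^+ 2, ln 2 / r2 ^+ 2).
have ln20 : 0 < ln 2 :> R by rewrite ln_gt0 // ltr1n.
have c1 : 0 < c.1 by rewrite divr_gt0 // exprn_gt0 // divr_gt0 ?subr_gt0.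
have c2 : 0 < c.2 by rewrite divr_gt0 // exprn_gt0 // divr_gt0 ?subr_gt0.
pose E1 x := gauss1 c.1 y.1 x.1; pose E2 x := gauss1 c.2 y.2 x.2.
have I1 x : 0 <= E1 x <= 1 by exact: gauss1_itv.
have I2 x : 0 <= E2 x <= 1 by exact: gauss1_itv.
pose F n x := g x * ((bump R n.+1).[E1 x] * (bump R n.+1).[E2 x]).
have Fv n : vanishing g (fun x => (bump R n.+1).[E1 x] * (bump R n.+1).[E2 x]).
  by apply: vanishing_poly => //; exact: bump_coef0.
pose D x := 16 * `|g x * gaussian c y x|.
have gE x : gaussian c y x = E1 x * E2 x.
  by have := gauss1X c y x 1 1; rewrite !expr1 !mul1r => ->; case: (c).
have Di : integrable2 D.
  by apply: integrable2Z; apply: integrable2_norm; have [] := gv c y c1 c2.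
have FD n x : `|F n x| <= D x.
  rewrite /F /D !normrM [leRHS]mulrCA; apply: ler_wpM2l => //; rewrite gE normrM.
  have /andP[a0 a1] := I1 x; have /andP[b0 b1] := I2 x.
  rewrite (ger0_norm a0) (ger0_norm b0).
  have /andP[u0 _] := bump_itv n.+1 a0 a1; have /andP[v0 _] := bump_itv n.+1 b0 b1.
  rewrite (ger0_norm u0) (ger0_norm v0).
  have -> : 16 * (E1 x * E2 x) = (4 * E1 x) * (4 * E2 x) by ring.
  by apply: ler_pM => //; exact: bump_le.
have FB x : F n x @[n --> \oo] --> (g \_ (closed_box p)) x.
  have memE : (x \in closed_box p) = (2^-1 <= E1 x) && (2^-1 <= E2 x).
    rewrite /E1 /E2 /c /y /= -!mem_itv_gauss1 //.
    by apply/idP/andP => [/set_mem[]|[? ?]] //; apply/mem_set; split.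
  have /andP[a0 a1] := I1 x; have /andP[b0 b1] := I2 x.
  have bdd (E : R) : 0 <= E -> E <= 1 ->
      (bump R n.+1).[E] @[n --> \oo] --> (if 2^-1 <= E then 1 else 0 : R).
    by move=> ? ?; case: leP => ?; [exact: cvg_bump1|exact: cvg_bump0].
  rewrite patchE memE.
  rewrite (_ : (if _ then _ else _) =
     g x * ((if 2^-1 <= E1 x then 1 else 0) * (if 2^-1 <= E2 x then 1 else 0))).
    by apply: cvgM; [exact: cvg_cst|apply: cvgM; exact: bdd].
  by case: (2^-1 <= E1 x); case: (2^-1 <= E2 x) => /=;
    rewrite ?mulr1 ?mulr0 ?mul0r ?mulr0.
have [|||||Bi _ cv] := @dominated_convergence _ _ _ mu2 setT measurableT
  (fun n x => (F n x)%:E) (fun x => ((g \_ (closed_box p)) x)%:E) (fun x => (D x)%:E).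
- by move=> n; apply/measurable_EFinP; exact: (integrable2_measurable (Fv n).1).
- apply/measurable_EFinP; apply: (@measurable_restrictT _ _ plane _ _ g mB).1.
  exact: measurable_funS mg.
- by apply/aeW => x _; apply: cvg_EFin; [exact: nearW|exact: FB].
- exact: Di.
- by apply/aeW => x n _; rewrite lee_fin.
split.
  apply: (@integrable_mkcond _ _ _ mu2 _ (EFin \o g) mB).2.
  by rewrite restrict_EFin.
rewrite integral_mkcond restrict_EFin.
apply: (cvg_unique _ cv) => //.
rewrite (_ : (fun n => _) = cst 0%E); first exact: cvg_cst.
apply/funext => n; have [Fi F0] := Fv n.
by rewrite -[LHS]fineK ?integrable_fin_num //; congr EFin; exact: F0.
Qed.

End GaussianSeparation.

(** * Schwartz functions *)

Section Schwartz.
Variable R : realType.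
Implicit Types (x y a z : R * R) (f g phi : R * R -> R) (b : bool) (c d : R).

(** Membership is proved by exhibiting a class of rapidly decreasing functions
    stable under both partial derivatives; no formula for the iterated
    derivatives is then required. *)
Lemma schwartz_coind (K : (R * R -> R) -> Prop) :
  (forall f, K f -> has_partials f /\ rapid f) ->
  (forall f b, K f -> K (pd b f)) ->
  forall f, K f -> schwartz f.
Proof.
move=> K1 Kpd f Kf w; apply: K1.
by elim: w => // b w IH; exact: (Kpd _ b).
Qed.

Lemma schwartz_has_partials f : schwartz f -> has_partials f.
Proof. by move=> /(_ [::])[]. Qed.

Lemma schwartz_rapid f : schwartz f -> rapid f.
Proof. by move=> /(_ [::])[]. Qed.

Lemma schwartz_pd b f : schwartz f -> schwartz (pd b f).
Proof.
move=> fs w; have := fs (rcons w b).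
by rewrite /partials foldr_rcons.
Qed.

Lemma schwartz_is_pd b f x : schwartz f -> is_pd b f x (pd b f x).
Proof. by move/schwartz_has_partials/has_partialsP. Qed.

Lemma rapid_bounded f : rapid f -> exists C, forall x, `|f x| <= C.
Proof. by move=> /(_ 0)[C CP]; exists C => x; have := CP x; rewrite expr0 mul1r. Qed.

Lemma continuous_bounded_partials f : has_partials f ->
  (forall b, exists C, forall x, `|pd b f x| <= C) -> continuous f.
Proof.
move=> fp fC; apply: continuous_locally_bounded_partials => // x.
have [C CP] := fC true; have [D DP] := fC false.
exists (Num.max C D), 1; split=> // b y _ _.
by rewrite le_max; apply/orP; case: b; [left; exact: CP|right; exact: DP].
Qed.

Lemma schwartz_continuous f : schwartz f -> continuous f.
Proof.
move=> fs; apply: continuous_bounded_partials; first exact: schwartz_has_partials.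
by move=> b; apply/rapid_bounded/schwartz_rapid/schwartz_pd.
Qed.

Lemma schwartz_measurable f : schwartz f -> measurable_fun setT f.
Proof. by move/schwartz_continuous/continuous_plane_measurable. Qed.

Lemma schwartz_integrable f : schwartz f -> integrable2 f.
Proof.
by move=> fs; apply: rapid_integrable; [exact: schwartz_measurable|exact: schwartz_rapid].
Qed.

Lemma has_partials_pd f (l : bool -> R * R -> R) :
  (forall b x, is_pd b f x (l b x)) -> forall b, pd b f = l b.
Proof. by move=> fl; have [] := partials_of fl. Qed.

Lemma schwartzZD c f g : schwartz f -> schwartz g -> schwartz (fun x => c * f x + g x).
Proof.
move=> fs gs; apply: (@schwartz_coind (fun h => exists f g,
   [/\ schwartz f, schwartz g & h = fun x => c * f x + g x])); last first.
- by exists f, g.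
- move=> _ b [{fs gs}f [{}g [fs gs ->]]].
  exists (pd b f), (pd b g); split; [exact: schwartz_pd..|].
  apply: (@has_partials_pd _ (fun b x => c * pd b f x + pd b g x)) => b' x.
  by apply: is_pdD; [apply: is_pdZ|]; exact: schwartz_is_pd.
- move=> _ [{fs gs}f [{}g [fs gs ->]]]; split.
    have [] := @partials_of _ (fun x => c * f x + g x) (fun b x => c * pd b f x + pd b g x) => // b x.
    by apply: is_pdD; [apply: is_pdZ|]; exact: schwartz_is_pd.
  by apply: rapidD; [apply: rapidZ|]; exact: schwartz_rapid.
Qed.

Lemma schwartz0 : schwartz (fun=> 0 : R).
Proof.
apply: (@schwartz_coind (fun h => h = fun=> 0)) => // [_ ->|_ b ->].
  have [hp _] := @partials_of _ (fun=> 0 : R) (fun _ _ => 0) (fun b x => is_pd_cst b x 0).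
  by split=> // N; exists 0 => x; rewrite normr0 mulr0.
by apply: (@has_partials_pd _ (fun _ _ => 0)) => b' x; exact: is_pd_cst.
Qed.

Lemma schwartz_coord b f : schwartz f -> schwartz (fun x => coord b x * f x).
Proof.
move=> fs; apply: (@schwartz_coind (fun h => exists f g,
   [/\ schwartz f, schwartz g & h = fun x => coord b x * f x + g x])); last first.
- exists f, (fun=> 0); split=> //; first exact: schwartz0.
  by apply/funext => x; rewrite addr0.
- move=> _ b' [{fs}f [g [fs gs ->]]].
  exists (pd b' f), (fun x => (b' == b)%:R * f x + pd b' g x); split.
  + exact: schwartz_pd.
  + by apply: schwartzZD => //; exact: schwartz_pd.
  + apply: (@has_partials_pd _ (fun b' x => coord b x * pd b' f x +
      ((b' == b)%:R * f x + pd b' g x))) => b'' x.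
    rewrite addrA [X in X + _]addrC.
    apply: is_pdD; last exact: schwartz_is_pd.
    by apply: is_pdM; [exact: is_pd_coord|exact: schwartz_is_pd].
- move=> _ [{fs}f [g [fs gs ->]]]; split.
    have [] := @partials_of _ (fun x => coord b x * f x + g x)
      (fun b' x => (b' == b)%:R * f x + coord b x * pd b' f x + pd b' g x) => // b' x.
    apply: is_pdD; last exact: schwartz_is_pd.
    by apply: is_pdM; [exact: is_pd_coord|exact: schwartz_is_pd].
  by apply: rapidD; [apply: rapid_coord|]; exact: schwartz_rapid.
Qed.

(** Modulated Gaussians times polynomials: a class stable under partial
    derivatives, whence its members are Schwartz functions. *)
Inductive gaussian_wave a z y : (R * R -> R) -> Prop :=
| GaussianWave c : gaussian_wave a z y (fun x => gaussian a z x * cos (dot x y + c))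
| GaussianWaveZD (c : R) f g : gaussian_wave a z y f -> gaussian_wave a z y g ->
    gaussian_wave a z y (fun x => c * f x + g x)
| GaussianWave_coord b f : gaussian_wave a z y f ->
    gaussian_wave a z y (fun x => coord b x * f x).

Lemma is_pd_cos_dot b x y c : is_pd b (fun x => cos (dot x y + c)) x
  (coord b y * cos (dot x y + (c + pi / 2))).
Proof.
rewrite addrA cosDpihalf mulrC.
apply: (@is_pd_comp _ b (fun x => dot x y + c) _ _ cos).
rewrite -[coord b y]addr0; apply: is_pdD; last exact: is_pd_cst.
have -> : coord b y = ((b == true)%:R * y.1 + x.1 * 0) + ((b == false)%:R * y.2 + x.2 * 0).
  by case: b => /=; ring.
by apply: is_pdD; apply: is_pdM;
  (exact: (@is_pd_coord _ _ true) || exact: (@is_pd_coord _ _ false) || exact: is_pd_cst).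
Qed.

Lemma gaussian_wave_pd a z y f : gaussian_wave a z y f ->
  exists2 l : bool -> R * R -> R, (forall b x, is_pd b f x (l b x)) &
    forall b, gaussian_wave a z y (l b).
Proof.
elim=> [c|c f1 f2 _ [l1 l1P K1] _ [l2 l2P K2]|b' f1 K [l lP Kl]].
- pose B c x := gaussian a z x * cos (dot x y + c).
  have KB e : gaussian_wave a z y (B e) by exact: GaussianWave.
  exists (fun b x => (- (2 * coord b a)) * (coord b x * B c x) +
     (coord b y * B (c + pi / 2) x
      + ((2 * coord b a * coord b z - 1) * B c x + B c x))).
    move=> b x; have := is_pdM (is_pd_gaussian b a z x) (is_pd_cos_dot b x y c).
    by congr is_pd; rewrite /B; ring.
  move=> b; apply: GaussianWaveZD.
    by apply: GaussianWave_coord; exact: KB.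
  by apply: GaussianWaveZD; [exact: KB|apply: GaussianWaveZD; exact: KB].
- exists (fun b x => c * l1 b x + l2 b x) => [b x|b].
    by apply: is_pdD => //; exact: is_pdZ.
  exact: GaussianWaveZD.
- exists (fun b x => (b == b')%:R * f1 x + coord b' x * l b x) => [b x|b].
    by apply: is_pdM => //; exact: is_pd_coord.
  by apply: GaussianWaveZD => //; exact: GaussianWave_coord.
Qed.

Lemma cos_norm_le1 (s : R) : `|cos s| <= 1.
Proof. by rewrite ler_norml cos_geN1 cos_le1. Qed.

Lemma gaussian_wave_rapid a z y f : 0 < a.1 -> 0 < a.2 ->
  gaussian_wave a z y f -> rapid f.
Proof.
move=> a1 a2; elim=> [c|c f1 f2 _ r1 _ r2|b f1 _ r1].
- apply: (@rapidW _ _ (gaussian a z)); last exact: gaussian_rapid.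
  by move=> x; rewrite normrM ler_piMr // cos_norm_le1.
- by apply: rapidD => //; exact: rapidZ.
- exact: rapid_coord.
Qed.

Lemma gaussian_wave_schwartz a z y f : 0 < a.1 -> 0 < a.2 ->
  gaussian_wave a z y f -> schwartz f.
Proof.
move=> a1 a2; apply: schwartz_coind => {}f => [Kf|b Kf].
  split; last exact: gaussian_wave_rapid Kf.
  by have [l /partials_of[]] := gaussian_wave_pd Kf.
by have [l /has_partials_pd ->] := gaussian_wave_pd Kf.
Qed.

Lemma gaussian_schwartz a z : 0 < a.1 -> 0 < a.2 -> schwartz (gaussian a z).
Proof.
move=> a1 a2; rewrite (_ : gaussian a z = fun x => gaussian a z x * cos (dot x 0 + 0)).
  by apply: (@gaussian_wave_schwartz a z 0) => //; exact: GaussianWave.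
by apply/funext => x; rewrite /dot /= !mulr0 !addr0 cos0 mulr1.
Qed.

End Schwartz.

(** * The Fourier transform of Schwartz functions *)

Section Wave.
Variable R : realType.
Implicit Types (x xi : R * R) (phi : R * R -> R) (c : R).

(** The real-valued oscillatory integral with phase c; the phases 0 and pi / 2
    give the real and imaginary parts of the Fourier transform.  Keeping the
    phase free makes differentiation and multiplication by a coordinate act
    within this single family. *)
Definition wave phi c x : R := integral2 (fun xi => phi xi * cos (dot x xi + c)).

Lemma waveE phi c x : wave phi c x =
  integral2 (fun xi => phi xi * cos (dot x xi + c)).
Proof. by []. Qed.

End Wave.
(* Unfolding would let unification compare integrals by comparing integrands. *)
#[global] Opaque wave.

Section WaveTransform.
Variable R : realType.
Local Notation mu2 := (@plane_measure R).
Implicit Types (x y a z xi : R * R) (f g phi : R * R -> R) (b : bool) (c d : R).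

Lemma is_derive_integral2 (F dF : R -> R * R -> R) (G : R * R -> R) (s0 : R) :
  (forall s, integrable2 (F s)) ->
  (forall (s : R) xi, is_derive s 1 (F^~ xi) (dF s xi)) ->
  integrable2 G -> (forall s xi, `|dF s xi| <= G xi) ->
  is_derive s0 1 (fun s => integral2 (F s)) (integral2 (dF s0)).
Proof.
move=> Fi Fd Gi FG.
have G0 xi : 0 <= G xi by exact: le_trans (FG s0 xi).
have dE s xi : partial1of2 F s xi = dF s xi.
  by rewrite partial1of2E; have [_] := Fd s xi.
have s0I : `](s0 - 1), (s0 + 1)[%classic s0.
  by rewrite /= in_itv /= ltrBlDr !ltrDl ltr01.
have h1 (s : R) : `](s0 - 1), (s0 + 1)[%classic s ->
    mu2.-integrable setT (EFin \o F s) by move=> _; exact: Fi.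
have h2 (s : R) (xi : R * R) : `](s0 - 1), (s0 + 1)[%classic s -> [set: R * R] xi ->
    derivable (F^~ xi) s 1 by move=> _ _; have [] := Fd s xi.
have h3 (s : R) (xi : R * R) : `](s0 - 1), (s0 + 1)[%classic s -> [set: R * R] xi ->
    `|partial1of2 F s xi| <= G xi by move=> _ _; rewrite dE.
apply: DeriveDef.
  exact: (@derivable_under_integral _ _ _ mu2 F setT measurableT _ _ _ s0I h1 h2 G G0 Gi h3).
rewrite -derive1E.
rewrite (@differentiation_under_integral _ _ _ mu2 F setT measurableT _ _ _ s0I h1 h2 G G0 Gi h3).
by apply: eq_Rintegral => xi _; exact: dE.
Qed.

Lemma continuous_cos_dot x c : continuous (fun xi => cos (dot x xi + c)).
Proof.
move=> xi; apply: (@continuous_comp _ _ _ (fun xi => dot x xi + c) (@cos R));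
  last exact: continuous_cos.
by apply: cvgD; [apply: cvgD; apply: cvgM;
  (exact: cvg_cst || exact: cvg_fst || exact: cvg_snd)|exact: cvg_cst].
Qed.

Lemma measurable_cos_dot x c : measurable_fun setT (fun xi => cos (dot x xi + c)).
Proof. by apply: continuous_plane_measurable; exact: continuous_cos_dot. Qed.

Lemma dotC x y : dot x y = dot y x.
Proof. by rewrite /dot [x.1 * _]mulrC [x.2 * _]mulrC. Qed.

Lemma wave_integrand_le phi c x xi : `|phi xi * cos (dot x xi + c)| <= `|phi xi|.
Proof. by rewrite normrM ler_piMr // cos_norm_le1. Qed.

Lemma wave_integrable phi c x : schwartz phi ->
  integrable2 (fun xi => phi xi * cos (dot x xi + c)).
Proof.
move=> ps; apply: (integrable2_le _ _ (wave_integrand_le phi c x)).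
  by apply: measurable_funM; [exact: schwartz_measurable|exact: measurable_cos_dot].
exact/integrable2_norm/schwartz_integrable.
Qed.

Lemma wave_pi phi c x : schwartz phi -> wave phi (c + pi) x = - wave phi c x.
Proof.
move=> ps; rewrite !waveE -integral2N; last exact: wave_integrable.
by congr integral2; apply/funext => xi; rewrite addrA cosDpi mulrN.
Qed.

Lemma wave_bounded phi c x : schwartz phi ->
  `|wave phi c x| <= integral2 (fun xi => `|phi xi|).
Proof.
move=> ps; rewrite waveE.
apply: le_trans (le_normr_Rintegral _ (wave_integrable c x ps)) _ => //.
apply: le_Rintegral => //.
- exact: integrable2_norm (wave_integrable c x ps).
- exact/integrable2_norm/schwartz_integrable.
- by move=> xi _; exact: wave_integrand_le.
Qed.

(** Differentiation under the integral sign shifts the phase. *)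
Lemma is_pd_wave b phi c x : schwartz phi ->
  is_pd b (wave phi c) x (wave (fun xi => coord b xi * phi xi) (c + pi / 2) x).
Proof.
move=> ps; have cs := schwartz_coord b ps.
have := @is_derive_integral2
  (fun s xi => phi xi * cos (dot (axis_point b x s) xi + c))
  (fun s xi => coord b xi * phi xi * cos (dot (axis_point b x s) xi + (c + pi / 2)))
  (fun xi => `|coord b xi * phi xi|) (coord b x).
rewrite axis_point_coord -waveE => h.
rewrite /is_pd; under eq_fun do rewrite waveE.
apply: h.
- by move=> s; exact: wave_integrable.
- move=> s xi; have := is_pd_cos_dot b (axis_point b x s) xi c.
  rewrite /is_pd coord_axis_point; under eq_fun do rewrite axis_point_idem.
  by move=> /(is_deriveZ (phi xi)); rewrite /GRing.scale /= mulrA [phi xi * _]mulrC.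
- exact: (integrable2_norm (schwartz_integrable cs)).
- by move=> s xi; exact: (wave_integrand_le (fun xi => coord b xi * phi xi)).
Qed.

(** Integration by parts in the frequency variable. *)
Lemma wave_pd b phi c x : schwartz phi ->
  wave (pd b phi) c x = - (coord b x * wave phi (c + pi / 2) x).
Proof.
move=> ps; have dps := schwartz_pd b ps.
have [C C0 CP] := rapid_weight 0 (schwartz_rapid ps).
have [D D0 DP] := rapid_weight 0 (schwartz_rapid dps).
pose W xi := phi xi * cos (dot x xi + c).
have dW b' xi : is_pd b' W xi (pd b' phi xi * cos (dot x xi + c)
    + coord b' x * (phi xi * cos (dot x xi + (c + pi / 2)))).
  have h := is_pd_cos_dot b' xi x c; rewrite dotC in h.
  have -> : coord b' x * (phi xi * cos (dot x xi + (c + pi / 2))) =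
    phi xi * (coord b' x * cos (dot x xi + (c + pi / 2))) by ring.
  apply: is_pdM; first exact: schwartz_is_pd.
  by move: h; congr is_pd; apply/funext => z; rewrite dotC.
have dWE := has_partials_pd dW.
have cW phi' c' : schwartz phi' -> continuous (fun xi => phi' xi * cos (dot x xi + c')).
  by move=> ps' xi; apply: cvgM; [exact: schwartz_continuous|exact: continuous_cos_dot].
have : integral2 (pd b W) = 0.
  apply: (@integral2_pd_eq0 _ b W (C + D + `|coord b x| * C)).
  - by move=> xi; rewrite dWE.
  - rewrite dWE => xi; apply: cvgD; first exact: (cW _ _ dps).
    by apply: cvgM; [exact: cvg_cst|exact: (cW _ _ ps)].
  - move=> xi; apply: le_trans (wave_integrand_le phi c x xi) _.
    have := CP xi; rewrite expr0 mul1r => h; apply: le_trans h _.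
    apply: ler_wpM2r; first exact/ltW/weight_gt0.
    by rewrite -addrA lerDl addr_ge0 // mulr_ge0.
  - move=> xi; rewrite dWE; apply: le_trans (ler_normD _ _) _.
    have h1 := le_trans (wave_integrand_le (pd b phi) c x xi) _.
    have := DP xi; rewrite expr0 mul1r => /h1 {}h1.
    have h2 := le_trans (wave_integrand_le phi (c + pi / 2) x xi) _.
    have := CP xi; rewrite expr0 mul1r => /h2 {}h2.
    rewrite [`|coord b x * _|]normrM.
    have h3 := ler_wpM2l (normr_ge0 (coord b x)) h2.
    apply: le_trans (lerD h1 h3) _.
    have : 0 <= C * weight xi by rewrite mulr_ge0 // ltW // weight_gt0.
    by rewrite mulrDl mulrDl [`|coord b x| * (C * _)]mulrA; lra.
rewrite dWE !waveE integral2D; last 2 first.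
- exact: wave_integrable.
- exact/integrable2Z/wave_integrable.
rewrite integral2Z; last exact: wave_integrable.
by move/eqP; rewrite addr_eq0 => /eqP.
Qed.

Lemma coord_wave b phi c x : schwartz phi ->
  coord b x * wave phi c x = - wave (pd b phi) (c - pi / 2) x.
Proof. by move=> ps; rewrite wave_pd // opprK subrK. Qed.

(** Each factor |x| is traded for a derivative of phi by [coord_wave], and the
    transforms of those derivatives are bounded. *)
Lemma wave_rapid phi c : schwartz phi -> rapid (wave phi c).
Proof.
move=> ps N; elim: N phi c ps => [|N IH] phi c ps.
  by eexists => x; rewrite expr0 mul1r; exact: wave_bounded.
have [C0 P0] := IH phi c ps.
have [C1 P1] := IH _ (c - pi / 2) (schwartz_pd true ps).
have [C2 P2] := IH _ (c - pi / 2) (schwartz_pd false ps).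
have P1' x : (1 + enorm x) ^+ N * (`|coord true x| * `|wave phi c x|) <= C1.
  by rewrite -normrM (coord_wave true c x ps) normrN; exact: P1.
have P2' x : (1 + enorm x) ^+ N * (`|coord false x| * `|wave phi c x|) <= C2.
  by rewrite -normrM (coord_wave false c x ps) normrN; exact: P2.
exists (C0 + (C1 + C2)) => x.
apply: le_trans (lerD (P0 x) (lerD (P1' x) (P2' x))).
rewrite -!mulrDr exprSr -mulrA; apply: ler_wpM2l.
  by rewrite exprn_ge0 // ltW // onePenorm_gt0.
move: `|wave phi c x| (normr_ge0 (wave phi c x)) => w w0.
have := ler_wpM2r w0 (enorm_le x).
by rewrite -[coord true x]/(x.1) -[coord false x]/(x.2); lra.
Qed.

Lemma wave_C1 phi c : schwartz phi -> C1_space (wave phi c) /\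
  forall b, pd b (wave phi c) = wave (fun xi => coord b xi * phi xi) (c + pi / 2).
Proof.
have cont psi d : schwartz psi -> continuous (wave psi d).
  move=> ps; have [hp pdE] := partials_of (fun b x => is_pd_wave b d x ps).
  apply: continuous_bounded_partials => // b; rewrite pdE.
  by apply/rapid_bounded/wave_rapid/schwartz_coord.
move=> ps; apply: C1_space_of => [b x|b]; first exact: is_pd_wave.
by apply/cont/schwartz_coord.
Qed.

Lemma wave_measurable phi c : schwartz phi -> measurable_fun setT (wave phi c).
Proof. by move=> /(wave_C1 c)[[_ h _ _] _]; exact: continuous_plane_measurable. Qed.

End WaveTransform.

(** * Uniqueness of Fourier transforms *)

Section Fourier.
Variable R : realType.
Local Notation mu2 := (@plane_measure R).
Local Notation plane := (measurableTypeR R * measurableTypeR R)%type.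
Implicit Types (x y a z xi : R * R) (f g h phi : R * R -> R) (b : bool) (c d : R).
Implicit Types (F G : R * R -> R[i]).

(** Nonempty boxes have positive measure. *)
Lemma continuous_ae_eq0 f : continuous f -> {ae mu2, forall x, f x = 0} ->
  forall x, f x = 0.
Proof.
move=> cf [N [mN N0 fN]] x; apply/eqP/negPn/negP => fx0.
have /continuous_planeP/(_ (`|f x| / 2))[|r r0 rP] := cf x.
  by rewrite divr_gt0 // normr_gt0.
pose p := ((x.1 - r / 2, x.1 + r / 2), (x.2 - r / 2, x.2 + r / 2)).
have pN : closed_box p `<=` N.
  move=> y [/=]; rewrite !in_itv /= => /andP[? ?] /andP[? ?]; apply: fN => /= fy.
  have : `|f y - f x| <= `|f x| / 2.
    by apply: rP; apply/ltr_normlP; split; lra.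
  rewrite fy sub0r normrN => h.
  have : 0 < `|f x| by rewrite normr_gt0.
  lra.
have : (mu2 (closed_box p) <= mu2 N)%E.
  by apply: le_measure => //; rewrite inE //; exact: closed_box_measurable.
rewrite N0.
have -> : mu2 (closed_box p) = (lebesgue_measure `[p.1.1, p.1.2]%classic *
                  lebesgue_measure `[p.2.1, p.2.2]%classic)%E.
  by apply: product_measure1E; exact: measurable_itv.
rewrite !lebesgue_measure_itv /= !lte_fin.
have -> : x.1 - r / 2 < x.1 + r / 2 by lra.
have -> : x.2 - r / 2 < x.2 + r / 2 by lra.
rewrite -EFinM lee_fin leNgt mulr_gt0 //; lra.
Qed.

Lemma continuous_ae_eq f g : continuous f -> continuous g ->
  {ae mu2, forall x, f x = g x} -> forall x, f x = g x.
Proof.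
move=> cf cg fg x; apply/subr0_eq; move: x.
apply: (@continuous_ae_eq0 (fun x => f x - g x)).
  by move=> x; apply: cvgB; [exact: cf|exact: cg].
by apply: ae_plane_sub fg => x ->; rewrite subrr.
Qed.

Lemma is_pd_eq0_constant f : (forall b x, is_pd b f x 0) -> forall x, f x = f 0.
Proof.
move=> f0 [x1 x2].
have [c _] := @mean_value R (fun s => f (s, x2)) (fun=> 0) 0 x1
  (fun c _ => f0 true (c, x2)).
have [d _] := @mean_value R (fun s => f (0, s)) (fun=> 0) 0 x2
  (fun c _ => f0 false (0, c)).
by rewrite !mul0r => /subr0_eq <- /subr0_eq.
Qed.

Lemma integral2_gaussian_neq0 a : 0 < a.1 -> 0 < a.2 -> integral2 (gaussian a 0) != 0.
Proof.
move=> a1 a2; apply/eqP => h.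
have gs := gaussian_schwartz 0 a1 a2.
have gi := schwartz_integrable gs.
have : ae_eq mu2 setT (EFin \o gaussian a 0) (cst 0%E).
  apply/(ae_eq_integral_abs mu2 measurableT).
    by apply/measurable_EFinP; exact: schwartz_measurable.
  rewrite -[RHS]/(0%:E) -h /integral2 /Rintegral fineK; last exact: integrable_fin_num.
  by apply: eq_integral => x _; rewrite gee0_abs // lee_fin expR_ge0.
move=> h0.
have /continuous_ae_eq0 : {ae mu2, forall x, gaussian a 0 x = 0}.
  by apply: ae_plane_sub h0 => x /(_ I) [].
move=> /(_ (schwartz_continuous gs) 0) /eqP.
by rewrite gt_eqF // expR_gt0.
Qed.

Lemma waveZ (k : R) phi c x : schwartz phi ->
  wave (fun xi => k * phi xi) c x = k * wave phi c x.
Proof.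
move=> ps; rewrite !waveE -integral2Z; last exact: wave_integrable.
by congr integral2; apply/funext => xi; rewrite mulrA.
Qed.

(** The transform W of a Gaussian solves the first-order system
    dW/dx_b = - x_b / (2 a_b) W, since each derivative of the Gaussian is a
    multiple of its product with a coordinate; hence W is again a Gaussian. *)
Lemma wave_gaussian a x : 0 < a.1 -> 0 < a.2 ->
  wave (gaussian a 0) 0 x =
  integral2 (gaussian a 0) * gaussian ((4 * a.1)^-1, (4 * a.2)^-1) 0 x.
Proof.
move=> a1 a2; pose phi := gaussian a (0 : R * R); pose W := wave phi 0.
have ab b : 0 < coord b a by case: b.
have ps : schwartz phi by exact: gaussian_schwartz.
have pdphi b : pd b phi = fun xi => - (2 * coord b a) * (coord b xi * phi xi).
  apply: (@has_partials_pd _ _ (fun b xi => - (2 * coord b a) * (coord b xi * phi xi))).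
  move=> {}b xi; have := is_pd_gaussian b a 0 xi; congr is_pd.
  by rewrite (_ : coord b 0 = 0) ?subr0; [rewrite /phi; ring|case: b].
have dW b y : is_pd b W y (- (coord b y / (2 * coord b a)) * W y).
  have := is_pd_wave b 0 y ps; congr is_pd.
  have := wave_pd b (0 + pi / 2) y ps.
  rewrite pdphi waveZ; last exact: schwartz_coord.
  rewrite -addrA -splitr (wave_pi 0 y ps) -/(W y) => h.
  have a0 := ab b.
  apply: (@mulfI _ (- (2 * coord b a))); first by rewrite oppr_eq0 gt_eqF // mulr_gt0.
  by rewrite h; field; rewrite gt_eqF.
pose a' : R * R := (- (4 * a.1)^-1, - (4 * a.2)^-1).
have : forall b y, is_pd b (fun y => W y * gaussian a' 0 y) y 0.
  move=> b y; have := is_pdM (dW b y) (is_pd_gaussian b a' 0 y); congr is_pd.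
  rewrite (_ : coord b 0 = 0); last by case: b.
  rewrite (_ : coord b a' = - (4 * coord b a)^-1); last by case: b.
  by have a0 := ab b; field; rewrite gt_eqF.
move=> /is_pd_eq0_constant/(_ x).
have -> : gaussian a' 0 (0 : R * R) = 1.
  by rewrite /gaussian /= subrr expr0n /= !mulr0 addr0 oppr0 expR0.
have -> : gaussian a' 0 x = (gaussian ((4 * a.1)^-1, (4 * a.2)^-1) 0 x)^-1.
  rewrite /gaussian -expRN /=; congr expR.
  by move: (4 * a.1)^-1 (4 * a.2)^-1 => k1 k2; ring.
have -> : W 0 = integral2 phi.
  rewrite /W waveE; congr integral2; apply/funext => xi.
  by rewrite /dot /= !mul0r !addr0 cos0 mulr1.
move=> /(congr1 (fun r => r * gaussian ((4 * a.1)^-1, (4 * a.2)^-1) 0 x)).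
by rewrite mulr1 divfK // gt_eqF // expR_gt0.
Qed.

Lemma Re_realM (r : R) (w : R[i]) : complex.Re (r%:C%C * w) = r * complex.Re w.
Proof. by case: w => u v /=; rewrite mul0r subr0. Qed.

Lemma Im_realM (r : R) (w : R[i]) : complex.Im (r%:C%C * w) = r * complex.Im w.
Proof. by case: w => u v /=; rewrite mul0r addr0. Qed.

Lemma fourier_integralE phi x :
  fourier_integral phi x = (wave phi 0 x +i* wave phi (pi / 2) x)%C.
Proof.
rewrite /fourier_integral /cintegral !waveE /integral2; congr (_ +i* _)%C.
  by apply: eq_Rintegral => xi _; rewrite Re_realM /= addr0 dotC.
by apply: eq_Rintegral => xi _; rewrite Im_realM /= cosDpihalf dotC.
Qed.

(** The defining relation, split into real and imaginary parts: two real
    identities in the transforms of phase 0 and pi / 2. *)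
Lemma is_fourierP g F : is_fourier g F <->
  [/\ tempered g, tempered (fun xi => complex.Re (F xi)),
      tempered (fun xi => complex.Im (F xi)) &
      forall phi, schwartz phi ->
        integral2 (fun x => g x * wave phi 0 x) =
          integral2 (fun xi => complex.Re (F xi) * phi xi) /\
        integral2 (fun x => g x * wave phi (pi / 2) x) =
          integral2 (fun xi => complex.Im (F xi) * phi xi)].
Proof.
have E phi : (cintegral (fun x => (g x)%:C%C * fourier_integral phi x) =
   cintegral (fun xi => F xi * (phi xi)%:C%C)) <->
  (integral2 (fun x => g x * wave phi 0 x) =
      integral2 (fun xi => complex.Re (F xi) * phi xi) /\
    integral2 (fun x => g x * wave phi (pi / 2) x) =
      integral2 (fun xi => complex.Im (F xi) * phi xi)).
  rewrite /cintegral /integral2.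
  under eq_Rintegral do rewrite Re_realM fourier_integralE /=.
  under [X in (_ +i* X)%C = _]eq_Rintegral do rewrite Im_realM fourier_integralE /=.
  under [X in _ = (X +i* _)%C]eq_Rintegral do rewrite mulrC Re_realM mulrC.
  under [X in _ = (_ +i* X)%C]eq_Rintegral do rewrite mulrC Im_realM mulrC.
  by split=> [[-> ->]|[-> ->]].
by split=> -[? ? ? h]; split=> // phi /h /E.
Qed.

Lemma tempered_wave_integrable g phi c : tempered g -> schwartz phi ->
  integrable2 (fun x => g x * wave phi c x).
Proof.
move=> gt ps; apply: tempered_rapid_integrable => //.
  exact: wave_measurable.
exact: wave_rapid.
Qed.

Lemma tempered_schwartz_integrable g phi : tempered g -> schwartz phi ->
  integrable2 (fun x => g x * phi x).
Proof.
move=> gt ps; apply: tempered_rapid_integrable => //.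
  exact: schwartz_measurable.
exact: schwartz_rapid.
Qed.

Lemma tempered_schwartz_separation g : tempered g ->
  (forall phi, schwartz phi -> integral2 (fun x => g x * phi x) = 0) ->
  {ae mu2, forall x, g x = 0}.
Proof.
move=> gt g0; apply: gaussian_separation => // a y a1 a2.
by apply: g0; exact: gaussian_schwartz.
Qed.

Lemma temperedB f g : tempered f -> tempered g -> tempered (fun x => f x - g x).
Proof.
move=> ft gt; rewrite (_ : (fun x => _) = fun x => f x + -1 * g x).
  by apply: temperedD => //; exact: temperedZ.
by apply/funext => x; rewrite mulN1r.
Qed.

Lemma fourier_unique g F G : is_fourier g F -> is_fourier g G ->
  {ae mu2, forall xi, F xi = G xi}.
Proof.
move=> /is_fourierP[gt Fr Fi FP] /is_fourierP[_ Gr Gi GP].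
have H (p q : R * R -> R) : tempered p -> tempered q ->
    (forall phi, schwartz phi -> integral2 (fun x => p x * phi x) =
                                 integral2 (fun x => q x * phi x)) ->
    {ae mu2, forall x, p x = q x}.
  move=> pt qt pq.
  have : {ae mu2, forall x, p x - q x = 0}.
    apply: (@tempered_schwartz_separation (fun x => p x - q x)); first exact: temperedB.
    move=> phi ps; under eq_fun do rewrite mulrBl.
    rewrite integral2B; [|exact: tempered_schwartz_integrable..].
    by rewrite pq // subrr.
  by apply: ae_plane_sub => x /subr0_eq.
have h1 := H _ _ Fr Gr (fun phi ps => etrans (esym (FP phi ps).1) (GP phi ps).1).
have h2 := H _ _ Fi Gi (fun phi ps => etrans (esym (FP phi ps).2) (GP phi ps).2).
apply: ae_plane_sub (ae_plane_and h1 h2) => xi.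
by case: (F xi) (G xi) => ? ? [? ?] /= [-> ->].
Qed.

Lemma fourier_ae_eq g F G : is_fourier g F ->
  tempered (fun xi => complex.Re (G xi)) -> tempered (fun xi => complex.Im (G xi)) ->
  {ae mu2, forall xi, F xi = G xi} -> is_fourier g G.
Proof.
move=> /is_fourierP[gt Fr Fi FP] Gr Gi FG; apply/is_fourierP; split=> // phi ps.
have [-> ->] := FP phi ps; split.
  apply: (integral2_ae_eq _ _ _).2.
  - exact: tempered_schwartz_integrable.
  - by apply: integrable2_measurable; exact: tempered_schwartz_integrable.
  - by apply: ae_plane_sub FG => xi ->.
apply: (integral2_ae_eq _ _ _).2.
- exact: tempered_schwartz_integrable.
- by apply: integrable2_measurable; exact: tempered_schwartz_integrable.
- by apply: ae_plane_sub FG => xi ->.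
Qed.

(** Modulating a Gaussian translates its transform, so the transforms of
    Schwartz functions include translates of every Gaussian. *)
Lemma fourier_injective f g F : is_fourier f F -> is_fourier g F ->
  {ae mu2, forall x, f x = g x}.
Proof.
move=> /is_fourierP[ft _ _ fP] /is_fourierP[gt _ _ gP].
have fgt := temperedB ft gt.
have fg0 phi : schwartz phi ->
   integral2 (fun x => (f x - g x) * wave phi 0 x) = 0 /\
   integral2 (fun x => (f x - g x) * wave phi (pi / 2) x) = 0.
  move=> ps; have [f1 f2] := fP phi ps; have [g1 g2] := gP phi ps.
  split; under eq_fun do rewrite mulrBl;
    (rewrite integral2B; [|exact: tempered_wave_integrable..]).
    by rewrite f1 g1 subrr.
  by rewrite f2 g2 subrr.
suff : {ae mu2, forall x, f x - g x = 0} by apply: ae_plane_sub => x /subr0_eq.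
apply: gaussian_separation => // a y a1 a2.
pose a' : R * R := ((4 * a.1)^-1, (4 * a.2)^-1).
have a1' : 0 < a'.1 by rewrite invr_gt0 mulr_gt0.
have a2' : 0 < a'.2 by rewrite invr_gt0 mulr_gt0.
have a'E : a = ((4 * a'.1)^-1, (4 * a'.2)^-1).
  by rewrite /= !invfM !invrK !mulrA !mulVf // !mul1r; case: (a).
pose wv c xi := gaussian a' 0 xi * cos (dot xi (- y) + c).
have wvs c : schwartz (wv c).
  by apply: (@gaussian_wave_schwartz _ a' 0 (- y)) => //; exact: GaussianWave.
have key x : wave (wv 0) 0 x - wave (wv (pi / 2)) (pi / 2) x =
    integral2 (gaussian a' 0) * gaussian a y x.
  transitivity (wave (gaussian a' 0) 0 (x - y)).
    rewrite !waveE -integral2B; [|exact: wave_integrable..].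
    congr integral2; apply/funext => xi.
    rewrite /wv !addr0 !cosDpihalf.
    rewrite (_ : dot (x - y) xi = dot x xi + dot xi (- y)); last first.
      by rewrite /dot /=; ring.
    by rewrite cosD; ring.
  rewrite wave_gaussian // -a'E; congr (_ * _).
  by rewrite /gaussian /= !subr0.
have c0 := integral2_gaussian_neq0 a1' a2'.
apply: (mulfI c0); rewrite mulr0 -integral2Z; last first.
  by apply: tempered_schwartz_integrable => //; exact: gaussian_schwartz.
have [h1 _] := fg0 _ (wvs 0); have [_ h2] := fg0 _ (wvs (pi / 2)).
rewrite -[RHS](subrr 0) -[X in _ = X - _]h1 -[X in _ = _ - X]h2.
rewrite -integral2B; [|exact: tempered_wave_integrable..].
congr integral2; apply/funext => x.
by rewrite mulrCA -key mulrBr.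
Qed.

End Fourier.

(** * Derivatives and Fourier multipliers *)

Section FourierCalculus.
Variable R : realType.
Local Notation mu2 := (@plane_measure R).
Implicit Types (x y xi : R * R) (f g h phi : R * R -> R) (b : bool) (c d : R).
Implicit Types (F G m : R * R -> R[i]) (V W : R * R -> R * R).

(** Outside a large ball the function is small; inside, it is bounded by
    compactness. *)
Lemma vanishes_bounded g : continuous g -> vanishes_at_infinity g ->
  exists C, forall x, `|g x| <= C.
Proof.
move=> cg /(_ 1 ltr01)[M MP].
pose I : set R := `[- M, M]%classic.
have cI : compact (I `*` I) by apply: compact_setX; exact: segment_compact.
have := continuous_compact (continuous_subspaceT cg) cI.
move=> /compact_bounded[N [_ /(_ (N + 1))]]; rewrite ltrDl ltr01 => /(_ isT) NP.
exists (Num.max 1 (N + 1)) => x; rewrite le_max.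
have [xM|Mx] := leP (enorm x) M; last by rewrite ltW // MP.
apply/orP; right; apply: NP; exists x => //.
have := le_trans (coord_le_enorm true x) xM.
have := le_trans (coord_le_enorm false x) xM.
by rewrite !ler_norml /= => hx2 hx1; split; rewrite /I /= in_itv.
Qed.

(** Integration by parts in space.  Boundedness of g suffices because the
    transform decreases rapidly. *)
Lemma integral2_pd_wave b g phi c (C : R) : C1_space g ->
  (forall x, `|g x| <= C) -> (forall x, `|pd b g x| <= C) -> schwartz phi ->
  integral2 (fun x => pd b g x * wave phi c x) =
  - integral2 (fun x => g x * wave (fun xi => coord b xi * phi xi) (c + pi / 2) x).
Proof.
move=> g1 gC dgC ps; have cps := schwartz_coord b ps.
pose w := wave phi c; pose w' := wave (fun xi => coord b xi * phi xi) (c + pi / 2).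
have C0 : 0 <= C by exact: le_trans (gC 0).
have [[_ cw _ _] _] := wave_C1 c ps; have [[_ cw' _ _] _] := wave_C1 (c + pi / 2) cps.
have [_ cg _ _] := g1; have cdg := C1_space_pd_continuous b g1.
have dE b' x : is_pd b' (fun x => g x * w x) x
   (pd b' g x * w x + g x * wave (fun xi => coord b' xi * phi xi) (c + pi / 2) x).
  by apply: is_pdM; [exact: C1_spaceP|exact: is_pd_wave].
have pdE := has_partials_pd dE.
have [A A0 AP] := rapid_weight 0 (wave_rapid c ps).
have [B B0 BP] := rapid_weight 0 (wave_rapid (c + pi / 2) cps).
have tg : tempered g by apply: tempered_bounded gC; exact: continuous_plane_measurable.
have tdg : tempered (pd b g).
  by apply: tempered_bounded dgC; exact: continuous_plane_measurable.
have : integral2 (pd b (fun x => g x * w x)) = 0.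
  have wA x : `|w x| <= A * weight x by have := AP x; rewrite expr0 mul1r.
  have wB x : `|w' x| <= B * weight x by have := BP x; rewrite expr0 mul1r.
  have CA x : C * `|w x| <= C * (A * weight x) by apply: ler_wpM2l => //.
  have CB x : C * `|w' x| <= C * (B * weight x) by apply: ler_wpM2l => //.
  apply: (@integral2_pd_eq0 _ b (fun x => g x * w x) (C * A + C * B)).
  - by move=> x; rewrite pdE; exact: dE.
  - rewrite pdE => x; apply: cvgD; apply: cvgM;
      [exact: cdg|exact: cw|exact: cg|exact: cw'].
  - move=> x; rewrite normrM; apply: le_trans (ler_wpM2r _ (gC x)) _ => //.
    apply: le_trans (CA x) _; rewrite mulrA ler_wpM2r ?(ltW (weight_gt0 _)) //.
    by rewrite lerDl mulr_ge0.
  - move=> x; rewrite pdE; apply: le_trans (ler_normD _ _) _; rewrite !normrM.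
    apply: le_trans (lerD (ler_wpM2r (normr_ge0 _) (dgC x))
                          (ler_wpM2r (normr_ge0 _) (gC x))) _.
    apply: le_trans (lerD (CA x) (CB x)) _.
    by rewrite mulrDl !mulrA.
rewrite pdE integral2D; [|exact: tempered_wave_integrable..].
by move/eqP; rewrite addr_eq0 => /eqP.
Qed.

Definition pd_symbol b xi : R[i] := (0 +i* coord b xi)%C.

Lemma is_fourier_pd b g F : decaying g -> is_fourier g F ->
  is_fourier (pd b g) (fun xi => pd_symbol b xi * F xi).
Proof.
move=> [g1 vg vg1 vg2 _] /is_fourierP[gt Fr Fi FP].
have [_ cg cg1 cg2] := g1.
have [C [gC dgC]] : exists C, (forall x, `|g x| <= C) /\ (forall x, `|pd b g x| <= C).
  have [C CP] := vanishes_bounded cg vg.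
  have [D DP] : exists D, forall x, `|pd b g x| <= D.
    by case: b; [exact: (vanishes_bounded cg1 vg1)|exact: (vanishes_bounded cg2 vg2)].
  by exists (Num.max C D); split=> x; rewrite le_max ?CP ?DP ?orbT.
have reE xi : complex.Re (pd_symbol b xi * F xi) = -1 * (coord b xi * complex.Im (F xi)).
  by case: (F xi) => p q /=; rewrite mul0r sub0r mulN1r.
have imE xi : complex.Im (pd_symbol b xi * F xi) = coord b xi * complex.Re (F xi).
  by case: (F xi) => p q /=; rewrite mul0r add0r.
apply/is_fourierP; split.
- apply: tempered_bounded dgC; apply: continuous_plane_measurable.
  exact: C1_space_pd_continuous.
- by under eq_fun do rewrite reE; apply: temperedZ; exact: tempered_coord.
- by under eq_fun do rewrite imE; exact: tempered_coord.
- move=> phi ps; have cps := schwartz_coord b ps; have [P1 P2] := FP _ cps.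
  rewrite !(integral2_pd_wave _ g1 gC dgC ps); split.
    rewrite add0r P2 -integral2N; last exact: tempered_schwartz_integrable.
    by congr integral2; apply/funext => xi; rewrite reE; ring.
  rewrite -splitr -[pi]add0r -integral2N; last exact: tempered_wave_integrable.
  under eq_fun do rewrite wave_pi // mulrN opprK.
  rewrite P1; congr integral2; apply/funext => xi; rewrite imE; ring.
Qed.

Lemma is_fourierD f g F G : is_fourier f F -> is_fourier g G ->
  is_fourier (fun x => f x + g x) (fun xi => F xi + G xi).
Proof.
move=> /is_fourierP[ft Fr Fi FP] /is_fourierP[gt Gr Gi GP].
have reE xi : complex.Re (F xi + G xi) = complex.Re (F xi) + complex.Re (G xi).
  by case: (F xi) (G xi) => ? ? [].
have imE xi : complex.Im (F xi + G xi) = complex.Im (F xi) + complex.Im (G xi).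
  by case: (F xi) (G xi) => ? ? [].
apply/is_fourierP; split.
- exact: temperedD.
- by under eq_fun do rewrite reE; exact: temperedD.
- by under eq_fun do rewrite imE; exact: temperedD.
- move=> phi ps; have [F1 F2] := FP _ ps; have [G1 G2] := GP _ ps; split.
    under eq_fun do rewrite mulrDl; under [in RHS]eq_fun do rewrite reE mulrDl.
    rewrite integral2D; [|exact: tempered_wave_integrable..].
    rewrite integral2D; [|exact: tempered_schwartz_integrable..].
    by rewrite F1 G1.
  under eq_fun do rewrite mulrDl; under [in RHS]eq_fun do rewrite imE mulrDl.
  rewrite integral2D; [|exact: tempered_wave_integrable..].
  rewrite integral2D; [|exact: tempered_schwartz_integrable..].
  by rewrite F2 G2.
Qed.

Lemma is_fourierN f F : is_fourier f F -> is_fourier (fun x => - f x) (fun xi => - F xi).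
Proof.
move=> /is_fourierP[ft Fr Fi FP].
have tN (h : R * R -> R) : tempered h -> tempered (fun x => - h x).
  by move=> /(temperedZ (-1)); under eq_fun do rewrite mulN1r.
have reE xi : complex.Re (- F xi) = - complex.Re (F xi) by case: (F xi).
have imE xi : complex.Im (- F xi) = - complex.Im (F xi) by case: (F xi).
apply/is_fourierP; split.
- exact: tN.
- by under eq_fun do rewrite reE; exact: tN.
- by under eq_fun do rewrite imE; exact: tN.
- move=> phi ps; have [F1 F2] := FP _ ps; split.
    under eq_fun do rewrite mulNr; under [in RHS]eq_fun do rewrite reE mulNr.
    rewrite integral2N; last exact: tempered_wave_integrable.
    by rewrite integral2N ?F1 //; exact: tempered_schwartz_integrable.
  under eq_fun do rewrite mulNr; under [in RHS]eq_fun do rewrite imE mulNr.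
  rewrite integral2N; last exact: tempered_wave_integrable.
  by rewrite integral2N ?F2 //; exact: tempered_schwartz_integrable.
Qed.

Lemma is_fourier0 : is_fourier (fun=> 0 : R) (fun=> 0 : R[i]).
Proof.
have t0 : tempered (fun=> 0 : R).
  by apply: (@tempered_bounded _ _ 0) => // x; rewrite normr0.
apply/is_fourierP; split=> // phi ps.
by split; under eq_fun do rewrite mul0r; under [in RHS]eq_fun do rewrite mul0r.
Qed.

Lemma is_fourier_curl V F1 F2 : decaying_vector V ->
  is_fourier (fst_comp V) F1 -> is_fourier (snd_comp V) F2 ->
  is_fourier (curl V) (fun xi => pd_symbol true xi * F2 xi - pd_symbol false xi * F1 xi).
Proof.
move=> [V1 V2] VF1 VF2.
exact: (is_fourierD (is_fourier_pd true V2 VF2) (is_fourierN (is_fourier_pd false V1 VF1))).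
Qed.

Lemma is_fourier_div V F1 F2 : decaying_vector V ->
  is_fourier (fst_comp V) F1 -> is_fourier (snd_comp V) F2 ->
  is_fourier (div V) (fun xi => pd_symbol true xi * F1 xi + pd_symbol false xi * F2 xi).
Proof.
move=> [V1 V2] VF1 VF2.
exact: (is_fourierD (is_fourier_pd true V1 VF1) (is_fourier_pd false V2 VF2)).
Qed.

(** The relation determines the image only almost everywhere, and its witnesses
    F may differ on a null set; continuity of the images settles both. *)
Lemma fourier_multiplier_unique m g h h' : fourier_multiplier m g h ->
  fourier_multiplier m g h' -> continuous h -> continuous h' -> h = h'.
Proof.
move=> [F [G [gF hG GF]]] [F' [G' [gF' hG' GF']]] ch ch'.
have FF := fourier_unique gF gF'.
have GG : {ae mu2, forall xi, G' xi = G xi}.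
  apply: ae_plane_sub (ae_plane_and FF (ae_plane_and GF GF')) => xi.
  by move=> [-> [-> ->]].
have [_ Gr Gi _] := hG.
have h'G := fourier_ae_eq hG' Gr Gi GG.
by apply/funext; exact: (continuous_ae_eq ch ch' (fourier_injective hG h'G)).
Qed.

Lemma fourier_multiplier0 m h : fourier_multiplier m (fun=> 0) h -> continuous h ->
  h = fun=> 0.
Proof.
move=> mh ch; apply: (fourier_multiplier_unique mh _ ch); last exact: cst_continuous.
exists (fun=> 0), (fun=> 0); split; [exact: is_fourier0|exact: is_fourier0|].
by apply: aeW => xi; rewrite mulr0.
Qed.

(** Multiplication by the symbol m commutes with multiplication by i xi_b. *)
Lemma multiplier_curl m V W : decaying_vector V -> decaying_vector W ->
  vector_multiplier m V W -> fourier_multiplier m (curl V) (curl W).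
Proof.
move=> Vd Wd [[F1 [G1 [VF1 WG1 GF1]]] [F2 [G2 [VF2 WG2 GF2]]]].
do 2 eexists; split; [exact: is_fourier_curl VF1 VF2|exact: is_fourier_curl WG1 WG2|].
by apply: ae_plane_sub (ae_plane_and GF1 GF2) => xi [-> ->]; rewrite mulrBr !(mulrCA (m xi)).
Qed.

Lemma multiplier_div m V W : decaying_vector V -> decaying_vector W ->
  vector_multiplier m V W -> fourier_multiplier m (div V) (div W).
Proof.
move=> Vd Wd [[F1 [G1 [VF1 WG1 GF1]]] [F2 [G2 [VF2 WG2 GF2]]]].
do 2 eexists; split; [exact: is_fourier_div VF1 VF2|exact: is_fourier_div WG1 WG2|].
by apply: ae_plane_sub (ae_plane_and GF1 GF2) => xi [-> ->]; rewrite mulrDr !(mulrCA (m xi)).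
Qed.

Lemma ae_neq0 : {ae mu2, forall xi : R * R, xi != 0}.
Proof.
pose p : (R * R) * (R * R) := ((0, 0), (0, 0)).
exists (closed_box p); split.
- exact: closed_box_measurable.
- transitivity (lebesgue_measure `[p.1.1, p.1.2]%classic *
                lebesgue_measure `[p.2.1, p.2.2]%classic)%E.
    by apply: product_measure1E; exact: measurable_itv.
  by rewrite !lebesgue_measure_itv /= !lte_fin ltxx mul0e.
- move=> xi /= /negP; rewrite negbK => /eqP ->.
  by split=> /=; rewrite in_itv /= lexx.
Qed.

(** A planar vector is determined by its components along and across a
    nonzero frequency, so a multiplier relation between two solenoidal fields
    can be read off their vorticities. *)
Lemma vector_multiplier_of_curl m V W : decaying_vector V -> decaying_vector W ->
  (forall x, div V x = 0) -> (forall x, div W x = 0) ->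
  fourier_multiplier m (curl V) (curl W) -> vector_multiplier m V W.
Proof.
move=> Vd Wd V0 W0 [F [G [VF WG GF]]].
have [[_ _ _ _ [F1 VF1]] [_ _ _ _ [F2 VF2]]] := Vd.
have [[_ _ _ _ [G1 WG1]] [_ _ _ _ [G2 WG2]]] := Wd.
have cV := fourier_unique VF (is_fourier_curl Vd VF1 VF2).
have cW := fourier_unique WG (is_fourier_curl Wd WG1 WG2).
have dV := is_fourier_div Vd VF1 VF2; have dW := is_fourier_div Wd WG1 WG2.
rewrite (_ : div V = fun=> 0) in dV; last exact/funext.
rewrite (_ : div W = fun=> 0) in dW; last exact/funext.
have {}dV := fourier_unique dV is_fourier0; have {}dW := fourier_unique dW is_fourier0.
have key : {ae mu2, forall xi, G1 xi = m xi * F1 xi /\ G2 xi = m xi * F2 xi}.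
  have := ae_plane_and (ae_plane_and GF ae_neq0)
    (ae_plane_and (ae_plane_and cV cW) (ae_plane_and dV dW)).
  apply: ae_plane_sub => xi [[GFx xi0] [[cVx cWx] [dVx dWx]]].
  rewrite {}cVx {}cWx in GFx.
  pose s := pd_symbol true xi; pose r := pd_symbol false xi.
  rewrite -/s -/r in GFx dVx dWx.
  have sr : s * s + r * r != 0.
    rewrite /s /r /pd_symbol; apply/eqP => -[] /=.
    rewrite !mul0r !sub0r -opprD => /eqP; rewrite oppr_eq0 -!expr2.
    rewrite paddr_eq0 ?sqr_ge0 // !expf_eq0 /= => /andP[/eqP x1 /eqP x2] _.
    by case/eqP: xi0; case: (xi) x1 x2 => ? ? /= -> ->.
  have dV' : r * F2 xi = - (s * F1 xi) by apply/eqP; rewrite -addr_eq0 addrC dVx.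
  have dW' : r * G2 xi = - (s * G1 xi) by apply/eqP; rewrite -addr_eq0 addrC dWx.
  split; apply: (mulfI sr).
    transitivity (- r * (s * G2 xi - r * G1 xi) + s * (s * G1 xi + r * G2 xi)); first by ring.
    rewrite dWx GFx.
    transitivity (m xi * (- r * (s * F2 xi - r * F1 xi) + s * (s * F1 xi + r * F2 xi)));
      last by ring.
    by rewrite dVx; ring.
  transitivity (s * (s * G2 xi - r * G1 xi) + r * (s * G1 xi + r * G2 xi)); first by ring.
  rewrite dWx GFx.
  transitivity (m xi * (s * (s * F2 xi - r * F1 xi) + r * (s * F1 xi + r * F2 xi)));
    last by ring.
  by rewrite dVx; ring.
split.
  by exists F1, G1; split=> //; apply: ae_plane_sub key => xi [].
by exists F2, G2; split=> //; apply: ae_plane_sub key => xi [].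
Qed.

End FourierCalculus.

(** * From one system to the other *)

Section Dynamics.
Variable R : realType.
Implicit Types (x y : R * R) (f g : R * R -> R) (b : bool) (t : R).
Implicit Types (U V D : R * R -> R * R) (u v : R -> R * R -> R * R).
Implicit Types (theta p : R -> R * R -> R).

Lemma C1_spaceD f g : C1_space f -> C1_space g -> C1_space (fun x => f x + g x).
Proof.
move=> f1 g1; apply: (@C1_space_of _ _ (fun b x => pd b f x + pd b g x) _ _).1.
  by move=> b x; apply: is_pdD; exact: C1_spaceP.
by move=> b x; apply: cvgD; exact: C1_space_pd_continuous.
Qed.

Lemma C1_spaceN f : C1_space f -> C1_space (fun x => - f x).
Proof.
move=> f1; apply: (@C1_space_of _ _ (fun b x => - pd b f x) _ _).1.
  by move=> b x; apply: is_pdN; exact: C1_spaceP.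
by move=> b x; apply: cvgN; exact: C1_space_pd_continuous.
Qed.

Lemma C1_spaceM f g : C1_space f -> C1_space g -> C1_space (fun x => f x * g x).
Proof.
move=> f1 g1.
apply: (@C1_space_of _ _ (fun b x => pd b f x * g x + f x * pd b g x) _ _).1.
  by move=> b x; apply: is_pdM; exact: C1_spaceP.
have [_ cf _ _] := f1; have [_ cg _ _] := g1.
by move=> b x; apply: cvgD; apply: cvgM;
  [exact: C1_space_pd_continuous|exact: cg|exact: cf|exact: C1_space_pd_continuous].
Qed.

Lemma C1_spacetime_slice (f : R -> R * R -> R) t : C1_spacetime f -> 0 <= t ->
  C1_space (f t).
Proof.
move=> [_ fp fc _ [f1 f2]] t0.
by split; [exact: fp|exact: continuous_spacetime_slice|
  exact: (continuous_spacetime_slice f1)|exact: (continuous_spacetime_slice f2)].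
Qed.

Lemma C1_dt (f : R -> R * R -> R) t : C1_spacetime f ->
  (forall b, C1_spacetime (fun s => pd b (f s))) -> 0 <= t ->
  C1_space (dt f t) /\ forall b, pd b (dt f t) = dt (fun s => pd b (f s)) t.
Proof.
move=> f1 df1 t0; apply: C1_space_of => [b x|b]; first exact: is_pd_dt.
by have [_ _ _ h _] := df1 b; exact: continuous_spacetime_slice.
Qed.

(** In the first component u_1 dx1 v_1 cancels and u_2 (dx2 v_1 - dx1 v_2)
    remains; similarly in the second. *)
Lemma curl_advective_nonlinearity U V x :
  curl_nonlinearity U V x = advective_nonlinearity U V x.
Proof.
rewrite /curl_nonlinearity /advective_nonlinearity /curl /advect /dot /smul /perp /grad /=.
by congr pair => /=; ring.
Qed.

(** The field (U_2, - U_1) is curl-free exactly when U is solenoidal; psi is its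
    potential. *)
Lemma stream_function U : C1_space (fst_comp U) -> C1_space (snd_comp U) ->
  (forall x, div U x = 0) ->
  exists psi, [/\ C2_space psi, U =1 grad_perp psi & laplacian psi = curl U].
Proof.
move=> U1 U2 dU.
have [|psi [psi1 psix psiy]] := poincare U2 (C1_spaceN U1).
  move=> x; have := dU x; rewrite /div => /eqP; rewrite addrC addr_eq0 => /eqP ->.
  rewrite -[RHS]/(pd true (fun y => - fst_comp U y) x).
  by apply/esym/is_pd_val/is_pdN; exact: C1_spaceP.
exists psi; split.
- split; [exact: psi1|by rewrite psix; exact: U2|].
  by rewrite psiy; apply: C1_spaceN; exact: U1.
- move=> x; rewrite /grad_perp psix psiy opprK.
  by rewrite /fst_comp /snd_comp; case: (U x).
- apply/funext => x; rewrite /laplacian /curl psix psiy; congr (_ + _).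
  rewrite -[LHS]/(pd false (fun y => - fst_comp U y) x).
  by apply/is_pd_val/is_pdN; exact: C1_spaceP.
Qed.

Lemma stream_function_solenoidal psi U : C2_space psi -> U =1 grad_perp psi ->
  (forall x, div U x = 0) /\ laplacian psi = curl U.
Proof.
move=> [[psip _ _ _] psi1 psi2] /funext UE.
have U1 : fst_comp U = fun x => - dx2 psi x by rewrite UE.
have U2 : snd_comp U = dx1 psi by rewrite UE.
have dU1 b x : pd b (fst_comp U) x = - pd b (dx2 psi) x.
  by rewrite U1; apply: is_pd_val; apply: is_pdN; exact: C1_spaceP.
split=> [x|]; last apply/funext => x.
  rewrite /div U2 -[dx1 _ x]/(pd true (fst_comp U) x) dU1 /=.
  by rewrite mixed_partials_commute // addrC subrr.
by rewrite /laplacian /curl U2 -[dx2 (fst_comp U) x]/(pd false (fst_comp U) x) dU1 /= opprK.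
Qed.

(** The left-hand side of the velocity equation minus the buoyancy, by
    components: the equation says that this field is - grad p. *)
Definition residual1 u v theta D t x : R :=
  dt (fun s => fst_comp (v s)) t x - curl (v t) x * snd_comp (u t) x + fst_comp D x.

Definition residual2 u v theta D t x : R :=
  dt (fun s => snd_comp (v s)) t x + curl (v t) x * fst_comp (u t) x + snd_comp D x
  - theta t x.

Section Residual.
Variables (nu alpha : R) (u v : R -> R * R -> R * R) (theta : R -> R * R -> R).
Hypothesis classical : classical_decaying nu alpha u v theta.
Variables (t : R) (t_ge0 : 0 <= t) (D : R * R -> R * R).
Hypothesis D_decaying : decaying_vector D.

Let pd_v1 b : C1_spacetime (fun s => pd b (fst_comp (v s))).
Proof. by case: b; [exact: (cd_dx1_v1 classical)|exact: (cd_dx2_v1 classical)]. Qed.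

Let pd_v2 b : C1_spacetime (fun s => pd b (snd_comp (v s))).
Proof. by case: b; [exact: (cd_dx1_v2 classical)|exact: (cd_dx2_v2 classical)]. Qed.

Lemma curl_C1 : C1_space (curl (v t)).
Proof.
apply: C1_spaceD; first exact: (C1_spacetime_slice (pd_v2 true)).
by apply: C1_spaceN; exact: (C1_spacetime_slice (pd_v1 false)).
Qed.

Let dt_v1 := C1_dt (cd_v1 classical) pd_v1 t_ge0.
Let dt_v2 := C1_dt (cd_v2 classical) pd_v2 t_ge0.

Let u1 : C1_space (fst_comp (u t)).
Proof. by have [[]] := cd_decay_u classical t_ge0. Qed.

Let u2 : C1_space (snd_comp (u t)).
Proof. by have [_ []] := cd_decay_u classical t_ge0. Qed.

Let D1 : C1_space (fst_comp D). Proof. by have [[]] := D_decaying. Qed.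
Let D2 : C1_space (snd_comp D). Proof. by have [_ []] := D_decaying. Qed.

Let theta1 : C1_space (theta t).
Proof. exact: (C1_spacetime_slice (cd_theta classical)). Qed.

Lemma residual1_C1 : C1_space (residual1 u v theta D t).
Proof.
have [dv1 _] := dt_v1.
apply: C1_spaceD; last exact: D1.
apply: C1_spaceD; first exact: dv1.
by apply: C1_spaceN; apply: C1_spaceM; [exact: curl_C1|exact: u2].
Qed.

Lemma residual2_C1 : C1_space (residual2 u v theta D t).
Proof.
have [dv2 _] := dt_v2.
apply: C1_spaceD; last by apply: C1_spaceN; exact: theta1.
apply: C1_spaceD; last exact: D2.
apply: C1_spaceD; first exact: dv2.
by apply: C1_spaceM; [exact: curl_C1|exact: u1].
Qed.

(** The curl of u^perp (curl v) is div ((curl v) u), which the product rule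
    splits into advection and a term in div u; the curl of dt v is dt (curl v)
    by the exchange of derivatives. *)
Lemma curl_residual x :
  dx1 (residual2 u v theta D t) x - dx2 (residual1 u v theta D t) x =
  dt (fun s => curl (v s)) t x + advect (u t) (curl (v t)) x
  + curl (v t) x * div (u t) x + curl D x - dx1 (theta t) x.
Proof.
have [dv1 dv1E] := dt_v1; have [dv2 dv2E] := dt_v2.
have P2 : is_pd true (residual2 u v theta D t) x
  (pd true (dt (fun s => snd_comp (v s)) t) x
   + (pd true (curl (v t)) x * fst_comp (u t) x
      + curl (v t) x * pd true (fst_comp (u t)) x)
   + pd true (snd_comp D) x - pd true (theta t) x).
  apply: is_pdB; last exact: (C1_spaceP true x theta1).
  apply: is_pdD; last exact: (C1_spaceP true x D2).
  apply: is_pdD; first exact: (C1_spaceP true x dv2).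
  by apply: is_pdM; [exact: (C1_spaceP true x curl_C1)|exact: (C1_spaceP true x u1)].
have P1 : is_pd false (residual1 u v theta D t) x
  (pd false (dt (fun s => fst_comp (v s)) t) x
   - (pd false (curl (v t)) x * snd_comp (u t) x
      + curl (v t) x * pd false (snd_comp (u t)) x)
   + pd false (fst_comp D) x).
  apply: is_pdD; last exact: (C1_spaceP false x D1).
  apply: is_pdB; first exact: (C1_spaceP false x dv1).
  by apply: is_pdM; [exact: (C1_spaceP false x curl_C1)|exact: (C1_spaceP false x u2)].
rewrite -[dx1 (residual2 _ _ _ _ _) x]/(pd true (residual2 u v theta D t) x).
rewrite -[dx2 (residual1 _ _ _ _ _) x]/(pd false (residual1 u v theta D t) x).
rewrite (is_pd_val P2) (is_pd_val P1) dv1E dv2E.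
have -> : dt (fun s => curl (v s)) t x =
    dt (fun s => pd true (snd_comp (v s))) t x - dt (fun s => pd false (fst_comp (v s))) t x.
  apply: dtB => [||//].
    by have [h _ _ _ _] := pd_v2 true; exact: h.
  by have [h _ _ _ _] := pd_v1 false; exact: h.
have alg (a1 a2 w wx wy r1 r2 r1x r2y Dx Dy th : R) :
    a1 + (wx * r1 + w * r1x) + Dx - th - (a2 - (wy * r2 + w * r2y) + Dy) =
    a1 - a2 + (r1 * wx + r2 * wy) + w * (r1x + r2y) + (Dx - Dy) - th by ring.
exact: alg.
Qed.

End Residual.

End Dynamics.

Section Equivalence.
Variable R : realType.
Variables (nu kappa alpha beta : R) (P : R -> R[i]).
Variables (omega theta : R -> R * R -> R) (u v : R -> R * R -> R * R).
Hypothesis classical : classical_decaying nu alpha u v theta.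
Hypothesis omega_curl :
  forall t : R, 0 <= t -> forall x : R * R, omega t x = curl (v t) x.
Hypothesis v_div : forall t : R, 0 <= t -> forall x : R * R, div (v t) x = 0.

Let omegaE t : 0 <= t -> omega t = curl (v t).
Proof. by move=> t0; apply/funext; exact: omega_curl. Qed.

Let dt_omega t x : 0 <= t -> dt omega t x = dt (fun s => curl (v s)) t x.
Proof. by move=> t0; apply: dt_eq. Qed.

Let v_decaying t : 0 <= t -> decaying_vector (v t).
Proof. exact: (cd_decay_v classical). Qed.

Let u_decaying t : 0 <= t -> decaying_vector (u t).
Proof. exact: (cd_decay_u classical). Qed.

Let decaying_C1 (f : R * R -> R) : decaying f -> C1_space f.
Proof. by case. Qed.

Let curl_continuous (V : R * R -> R * R) : decaying_vector V -> continuous (curl V).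
Proof.
move=> [[[_ _ _ V1] _ _ _ _] [[_ _ V2 _] _ _ _ _]] x.
by apply: cvgB; [exact: V2|exact: V1].
Qed.

Let div_continuous (V : R * R -> R * R) : decaying_vector V -> continuous (div V).
Proof.
move=> [[[_ _ V1 _] _ _ _ _] [[_ _ _ V2] _ _ _ _]] x.
by apply: cvgD; [exact: V1|exact: V2].
Qed.

Lemma velocity_equationP p D t x :
  dt_vec v t x + curl_nonlinearity (u t) (v t) x + D x =
    - grad p x + smul (theta t x) (e2 R) <->
  residual1 u v theta D t x = - dx1 p x /\ residual2 u v theta D t x = - dx2 p x.
Proof.
rewrite /residual1 /residual2 /dt_vec /curl_nonlinearity /smul /perp /grad /e2
  /fst_comp /snd_comp.
split=> [h|[h1 h2]].
  move: (congr1 fst h) (congr1 snd h) => /=; rewrite mulr0 mulr1 addr0 mulrN => -> h2.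
  by split=> //; rewrite h2; ring.
apply: injective_projections => /=.
  by rewrite mulr0 addr0 mulrN.
by rewrite mulr1 -h2; ring.
Qed.

(** P(Lambda) maps div v = 0 to div u. *)
Lemma solenoidal_drift t : 0 <= t ->
  vector_multiplier (radial P) (v t) (u t) -> forall x, div (u t) x = 0.
Proof.
move=> t0 m x.
have := multiplier_div (v_decaying t0) (u_decaying t0) m.
rewrite (_ : div (v t) = fun=> 0); last by apply/funext; exact: v_div.
by move=> /fourier_multiplier0 -> //; exact/div_continuous/u_decaying.
Qed.

(** The pressure is only C^1 to begin with, but its gradient is minus the
    residual, which is C^1; so its second derivatives exist, are symmetric, and
    the residual is curl-free. *)
Lemma vorticity_of_velocity : (exists p, velocity_system nu kappa alpha beta P v u p theta) ->
  exists psi, vorticity_system nu kappa alpha beta P omega u psi theta.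
Proof.
move=> [p [p1 veq _ um temp]].
have divu t (t0 : 0 <= t) := solenoidal_drift t0 (um t t0).
have /choice[psi psiP] : forall t, exists psi, 0 <= t ->
    [/\ C2_space psi, u t =1 grad_perp psi & laplacian psi = curl (u t)].
  move=> t; case: (leP 0 t) => [t0|_]; last by exists (fun=> 0).
  have [/decaying_C1 U1 /decaying_C1 U2] := u_decaying t0.
  by have [psi psiP] := stream_function U1 U2 (divu t t0); exists psi.
exists psi; split=> // t t0; last first.
  have [psi2 upsi lapE] := psiP t t0; split=> //.
  rewrite omegaE // lapE.
  exact: multiplier_curl (v_decaying t0) (u_decaying t0) (um t t0).
have [D [vD Deq]] := veq t t0.
have [D0 [vD0 D0d]] := cd_dissipation classical t0.
have gradp x : residual1 u v theta D t x = - dx1 (p t) x /\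
    residual2 u v theta D t x = - dx2 (p t) x by exact/velocity_equationP.
have [pp _ cp1 cp2] := p1 t t0.
have [R1 R2] := (residual1_C1 classical t0 D0d, residual2_C1 classical t0 D0d).
(* The two versions of the dissipative term have the same transform and are
   both continuous. *)
have [DE1 DE2] : fst_comp D = fst_comp D0 /\ snd_comp D = snd_comp D0.
  have [[D01 _ _ _ _] [D02 _ _ _ _]] := D0d.
  have [[_ cD1 _ _] [_ cD2 _ _]] := (D01, D02).
  have [[m1 m2] [m01 m02]] := (vD, vD0).
  have [[_ cR1 _ _] [_ cR2 _ _]] := (R1, R2).
  split.
  - apply: (fourier_multiplier_unique m1 m01 _ cD1).
    rewrite (_ : fst_comp D = fun x => - dx1 (p t) x - residual1 u v theta D0 t x
        + fst_comp D0 x).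
      move=> x; apply: cvgD; last exact: cD1.
      by apply: cvgB; [apply: cvgN; exact: cp1|exact: cR1].
    by apply/funext => x; rewrite -(gradp x).1 /residual1; ring.
  - apply: (fourier_multiplier_unique m2 m02 _ cD2).
    rewrite (_ : snd_comp D = fun x => - dx2 (p t) x - residual2 u v theta D0 t x
        + snd_comp D0 x).
      move=> x; apply: cvgD; last exact: cD2.
      by apply: cvgB; [apply: cvgN; exact: cp2|exact: cR2].
    by apply/funext => x; rewrite -(gradp x).2 /residual2; ring.
have p1E : dx1 (p t) = fun x => - residual1 u v theta D0 t x.
  by apply/funext => x; rewrite /residual1 -DE1 -/(residual1 u v theta D t x) (gradp x).1 opprK.
have p2E : dx2 (p t) = fun x => - residual2 u v theta D0 t x.
  by apply/funext => x; rewrite /residual2 -DE2 -/(residual2 u v theta D t x) (gradp x).2 opprK.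
exists (curl D0); split.
  by rewrite omegaE //; exact: (multiplier_curl (v_decaying t0) D0d vD0).
move=> x.
have C1p1 : C1_space (dx1 (p t)) by rewrite p1E; exact: C1_spaceN.
have C1p2 : C1_space (dx2 (p t)) by rewrite p2E; exact: C1_spaceN.
have := mixed_partials_commute x pp C1p1 C1p2.
rewrite p1E p2E.
have E2 : pd true (fun y => - residual2 u v theta D0 t y) x =
    - pd true (residual2 u v theta D0 t) x.
  by apply/is_pd_val/is_pdN; exact: (C1_spaceP true x R2).
have E1 : pd false (fun y => - residual1 u v theta D0 t y) x =
    - pd false (residual1 u v theta D0 t) x.
  by apply/is_pd_val/is_pdN; exact: (C1_spaceP false x R1).
rewrite /= in E1 E2.
rewrite {}E1 {}E2 => /oppr_inj E.
have := curl_residual classical t0 D0d x.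
rewrite {}E subrr (divu t t0) mulr0 addr0 => /esym/eqP; rewrite subr_eq0 => /eqP <-.
by rewrite dt_omega // omegaE.
Qed.

(** The dissipation of omega must be the curl of the dissipation of v: both are
    images of omega under the same multiplier and both are continuous, the
    former because the vorticity equation expresses it by continuous terms. *)
Lemma velocity_of_vorticity : (exists psi, vorticity_system nu kappa alpha beta P omega u psi theta) ->
  exists p, velocity_system nu kappa alpha beta P v u p theta.
Proof.
move=> [psi [weq psiP temp]].
have stream t : 0 <= t -> (forall x, div (u t) x = 0) /\ laplacian (psi t) = curl (u t).
  by move=> t0; have [psi2 upsi _] := psiP t t0; exact: stream_function_solenoidal.
have um t : 0 <= t -> vector_multiplier (radial P) (v t) (u t).
  move=> t0; have [divu lapE] := stream t t0; have [_ _ m] := psiP t t0.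
  rewrite lapE omegaE // in m.
  exact: (vector_multiplier_of_curl (v_decaying t0) (u_decaying t0) (v_div t0) divu m).
have key t : exists p, 0 <= t -> C1_space p /\ exists D,
    vector_multiplier (dissipation nu alpha) (v t) D /\
    forall x, residual1 u v theta D t x = - dx1 p x /\
              residual2 u v theta D t x = - dx2 p x.
  case: (leP 0 t) => [t0|_]; last by exists (fun=> 0).
  have [divu _] := stream t t0.
  have [D0 [vD0 D0d]] := cd_dissipation classical t0.
  have [Dw [wD weqt]] := weq t t0.
  have C1w := curl_C1 classical t0.
  have [R1 R2] := (residual1_C1 classical t0 D0d, residual2_C1 classical t0 D0d).
  have CR x := curl_residual classical t0 D0d x.
  have [_ _ cR2x _] := R2; have [_ _ _ cR1y] := R1.
  have [[U1 _ _ _ _] [U2 _ _ _ _]] := u_decaying t0.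
  have [_ cD0] := (D0d, curl_continuous D0d).
  have DwE : Dw = curl D0.
    rewrite omegaE // in wD.
    apply: (fourier_multiplier_unique wD
      (multiplier_curl (v_decaying t0) D0d vD0) _ cD0).
    rewrite (_ : Dw = fun x => curl D0 x
      - (dx1 (residual2 u v theta D0 t) x - dx2 (residual1 u v theta D0 t) x)).
      move=> x; apply: cvgB; first exact: cD0.
      by apply: cvgB; [exact: cR2x|exact: cR1y].
    apply/funext => x; rewrite CR divu mulr0 addr0 -(weqt x) dt_omega // omegaE //.
    by ring.
  have [|p [p1 px py]] := poincare (C1_spaceN R1) (C1_spaceN R2).
    move=> x.
    rewrite -[LHS]/(pd false (fun y => - residual1 u v theta D0 t y) x).
    rewrite -[RHS]/(pd true (fun y => - residual2 u v theta D0 t y) x).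
    rewrite (is_pd_val (is_pdN (C1_spaceP false x R1))).
    rewrite (is_pd_val (is_pdN (C1_spaceP true x R2))) /=.
    congr (- _); apply/esym/eqP; rewrite -subr_eq0 CR divu mulr0 addr0.
    by rewrite -DwE -(weqt x) dt_omega // omegaE // subrr.
  exists p => _; split=> //; exists D0; split=> // x.
  by rewrite px py !opprK.
have /choice[p pP] := key.
exists p; split=> // t t0; first by have [] := pP t t0.
have [_ [D [vD Deq]]] := pP t t0.
by exists D; split=> // x; apply/velocity_equationP; exact: Deq.
Qed.

End Equivalence.

Theorem theorem2p1 (R : realType) (nu kappa alpha beta : R) (P : R -> R[i])
    (nu_ge0 : 0 <= nu) (kappa_ge0 : 0 <= kappa)
    (alpha_gt0 : 0 < alpha) (alpha_le1 : alpha <= 1)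
    (beta_gt0 : 0 < beta) (beta_le1 : beta <= 1)
    (omega theta : R -> R * R -> R) (u v : R -> R * R -> R * R)
    (classical : classical_decaying nu alpha u v theta)
    (omega_curl : forall t : R, 0 <= t -> forall x : R * R, omega t x = curl (v t) x)
    (v_div : forall t : R, 0 <= t -> forall x : R * R, div (v t) x = 0) :
  ((exists psi : R -> R * R -> R,
      vorticity_system nu kappa alpha beta P omega u psi theta) <->
   (exists p : R -> R * R -> R,
      velocity_system nu kappa alpha beta P v u p theta)) /\
  (forall p : R -> R * R -> R,
     velocity_equation (@curl_nonlinearity R) nu alpha v u p theta <->
     velocity_equation (@advective_nonlinearity R) nu alpha v u p theta).
Proof.
split.
  split; first exact: velocity_of_vorticity.
  exact: vorticity_of_velocity.
by move=> p; split=> h t t0; have [D [vD Deq]] := h t t0; exists D; split=> // x;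
  have := Deq x; rewrite curl_advective_nonlinearity.
Qed.
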